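(* Let $d\geq 1$ and $\theta>0$. For each $n$, consider the complete graph $K_n$ whose edges $\{i,j\}$ are assigned lengths $l_{i,j}=(nX_{i,j})^{1/d}$, where the $X_{i,j}$ are independent exponential random variables with mean $1$. Let $M_n(\theta)$ be the total length of the edges belonging to the optimum diluted matching of $K_n$ with parameter $\theta$. Then there is a number $\beta_\theta(d)$ such that $$\frac{M_n(\theta)}{n}\to\beta_\theta(d)\quad\text{in probability as } n\to\infty.$$
   Context: A partial matching of a graph is a set of edges no two of which share a vertex. The diluted matching problem with parameter $\theta$ asks for the partial matching minimizing the sum of the lengths of its edges plus $\theta/2$ times the number of vertices not covered by the matching; the optimum diluted matching is a minimizer of this cost (almost surely unique here since edge lengths have a continuous distribution). *)

(* Defs.v *)
From HB Require Import structures.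
From mathcomp Require Import all_boot all_order all_algebra.
From mathcomp Require Import all_classical all_reals all_analysis.
From mathcomp Require Import exponential_distribution.
Set Implicit Arguments. Unset Strict Implicit. Unset Printing Implicit Defensive.
Import Order.TTheory GRing.Theory Num.Theory.
Local Open Scope classical_set_scope.
Local Open Scope ring_scope.

Section DilutedMatching.
Variables (R : realType) (n : nat).

Definition is_edge (e : 'I_n * 'I_n) : bool := (e.1 < e.2)%N.

Definition vertex_disjoint (e f : 'I_n * 'I_n) : bool :=
  [&& e.1 != f.1, e.1 != f.2, e.2 != f.1 & e.2 != f.2].

Definition is_matching (m : {set 'I_n * 'I_n}) : bool :=
  [forall e in m, is_edge e] &&
  [forall e in m, forall f in m, (e != f) ==> vertex_disjoint e f].

Definition covered (m : {set 'I_n * 'I_n}) (v : 'I_n) : bool :=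
  [exists e in m, (v == e.1) || (v == e.2)].

Definition dm_cost (l : 'I_n -> 'I_n -> R) (theta : R) (m : {set 'I_n * 'I_n}) : R :=
  \sum_(e in m) l e.1 e.2 + theta / 2 * (#|[set v | ~~ covered m v]|)%:R.

(* an optimum diluted matching (a minimiser of dm_cost among matchings;
   the empty set is a matching, used as the default) *)
Definition opt_dm (l : 'I_n -> 'I_n -> R) (theta : R) : {set 'I_n * 'I_n} :=
  [arg min_(m < (finset.set0 : {set 'I_n * 'I_n}) | is_matching m) dm_cost l theta m]%O.

Definition opt_dm_length (l : 'I_n -> 'I_n -> R) (theta : R) : R :=
  \sum_(e in opt_dm l theta) l e.1 e.2.

End DilutedMatching.

Definition edge_lengths (R : realType) (d : R) (n : nat) (x : 'I_n -> 'I_n -> R)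
  : 'I_n -> 'I_n -> R :=
  fun i j => powR (n%:R * x i j) d^-1.

Definition M_n (R : realType) (d theta : R) (n : nat) (T : Type)
  (X : 'I_n -> 'I_n -> T -> R) (w : T) : R :=
  opt_dm_length (edge_lengths d (fun i j => X i j w)) theta.

Definition edges_independent (R : realType) (dT : measure_display)
  (T : measurableType dT) (P : probability T R) (n : nat)
  (Y : 'I_n * 'I_n -> T -> R) : Prop :=
  forall (F : {set 'I_n * 'I_n}) (B : 'I_n * 'I_n -> set R),
    F \subset [set e | is_edge e] ->
    (forall e, measurable (B e)) ->
    P (\big[setI/setT]_(e in F) (Y e @^-1` B e)) =
    (\prod_(e in F) P (Y e @^-1` B e))%E.

(* Main.v *)
(* With [W lam] the maximal weight of a matching for the edge weights
   [theta - lam * l], the cost of a matching is [n theta / 2] minus its weight for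
   [lam = 1], and the length of the optimum is minus a subgradient of the convex
   function [W] at [lam = 1].  It is thus trapped between the slopes of [W] over
   [1 - h, 1] and [1, 1 + h], and it suffices to show that [W lam / n] is
   asymptotically deterministic and smooth in [lam], up to an error [o(h)].
   Rounding the weights to multiples of [theta / M] turns the gain of a vertex
   (the increase of [W] when the vertex is added to the graph) into an integer in
   [0, M] which satisfies [g(v, A) = max_i (x(v, i) - g(i, A - i))].  Starting this
   recursion from 0 at depth [k] gives lower bounds for even [k] and upper bounds
   for odd [k].  For fixed [M] and [k], second moments show that the sums of the
   truncated gains concentrate around the solution of an explicit recursion.  Its
   even and odd limits as [k] grows differ by o(M) as [M] grows: they solve a pair
   of coupled equations whose kernel is symmetric, and summation by parts forces
   the two solutions together. *)

Require Import Defs.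
From HB Require Import structures.
From mathcomp Require Import all_boot all_order all_algebra.
From mathcomp Require Import all_classical all_reals all_analysis.
From mathcomp Require Import measurable_realfun exponential_distribution.
From mathcomp Require Import ring lra zify.
Set Implicit Arguments. Unset Strict Implicit. Unset Printing Implicit Defensive.
Import Order.TTheory GRing.Theory Num.Theory.
Import numFieldNormedType.Exports.
Local Open Scope classical_set_scope.
Local Open Scope ring_scope.

(** * Finite product measures *)

(** Multiplying all lengths by [lam] has the same effect as replacing [n] by [N = n * lam ^ d], so
    [lam] enters only through ratios [s = j / N] of the size of a graph to the scale of its edges.
    Adding the vertices one at a time turns [W lam / n], in units of [theta / M], into about
    [lam ^ d * G (1 / lam ^ d)], where [G] is a primitive of the mean gain [xlim] as a function of
    [s]. The slopes on the two sides of [lam = 1] then evaluate [xlim] at two nearby but different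
    ratios. This shapes the comparison of odd and even depths: it is proved for pairs [s], [s'] at
    distance at most [eta], with [eta] chosen before [M] and [k]. It thus gives closeness of the two
    bounds and, at the same time, a continuity in [s] that is uniform in the depth; the Lipschitz
    constant of [xlim] at depth [k] does not give the latter, since its recursive bound may grow
    geometrically with [k]. All estimates are uniform over probability spaces, so that the limit can
    be named before the space is given. *)

Section FiniteProduct.
Variables (R : realType) (I : finType) (M : nat) (p : I -> 'I_M.+1 -> R).
Hypothesis p_ge0 : forall e j, 0 <= p e j.
Hypothesis p_sum1 : forall e, \sum_j p e j = 1.

Implicit Types (f g : {ffun I -> 'I_M.+1} -> R) (w : {ffun I -> 'I_M.+1}).

Definition pweight w : R := \prod_e p e (w e).

Definition Ex f : R := \sum_w pweight w * f w.

Definition upd w (e : I) (j : 'I_M.+1) : {ffun I -> 'I_M.+1} :=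
  [ffun i => if i == e then j else w i].

Lemma pweight_ge0 w : 0 <= pweight w.
Proof. exact: prodr_ge0. Qed.

Lemma Ex_ext f g : f =1 g -> Ex f = Ex g.
Proof. by move=> fg; apply: eq_bigr => w _; rewrite fg. Qed.

Lemma ExD f g : Ex (fun w => f w + g w) = Ex f + Ex g.
Proof. by rewrite /Ex -big_split; apply: eq_bigr => w _; rewrite mulrDr. Qed.

Lemma ExZ (c : R) f : Ex (fun w => c * f w) = c * Ex f.
Proof. by rewrite /Ex big_distrr; apply: eq_bigr => w _ /=; rewrite mulrCA. Qed.

Lemma ExB f g : Ex (fun w => f w - g w) = Ex f - Ex g.
Proof.
under Ex_ext do rewrite -mulN1r.
by rewrite ExD ExZ mulN1r.
Qed.

Lemma Ex_sum (J : Type) (r : seq J) (P : pred J) (F : J -> _ -> R) :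
  Ex (fun w => \sum_(i <- r | P i) F i w) = \sum_(i <- r | P i) Ex (F i).
Proof.
rewrite /Ex exchange_big /=; apply: eq_bigr => w _; rewrite big_distrr //.
Qed.

Lemma ler_Ex f g : (forall w, f w <= g w) -> Ex f <= Ex g.
Proof. by move=> fg; apply: ler_sum => w _; rewrite ler_wpM2l ?pweight_ge0. Qed.

Lemma Ex_ge0 f : (forall w, 0 <= f w) -> 0 <= Ex f.
Proof. by move=> f0; apply: sumr_ge0 => w _; rewrite mulr_ge0 ?pweight_ge0. Qed.

Lemma Ex_cst (c : R) : Ex (fun=> c) = c.
Proof.
rewrite /Ex -big_distrl /=.
rewrite -(bigA_distr_bigA (fun e j => p e j)) big1 ?mul1r//.
Qed.

Lemma upd_upd w e j : upd (upd w e j) e (w e) = w.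
Proof. by apply/ffunP => i; rewrite !ffunE; case: eqP => // ->. Qed.

Lemma pweight_upd w e j : pweight (upd w e j) * p e (w e) = pweight w * p e j.
Proof.
rewrite /pweight (bigD1 e) //= [in RHS](bigD1 e) //= ffunE eqxx.
rewrite mulrAC [RHS]mulrAC [p e j * _]mulrC; congr (_ * _).
by apply: eq_bigr => i /negbTE ie; rewrite ffunE ie.
Qed.

(* (w, j) |-> (upd w e j, w e) is an involution of the product with a fresh
   copy of the coordinate e, and it preserves the weights. *)
Lemma Ex_resample e f : Ex f = Ex (fun w => \sum_j p e j * f (upd w e j)).
Proof.
pose h (x : {ffun I -> 'I_M.+1} * 'I_M.+1) := (upd x.1 e x.2, x.1 e).
have hK : involutive h.
  by case=> w j; rewrite /h /= upd_upd ffunE eqxx.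
rewrite /Ex; under [RHS]eq_bigr do rewrite big_distrr /=.
rewrite pair_big /= (reindex_inj (inv_inj hK)) /=.
rewrite -(pair_big xpredT xpredT
  (fun w j => pweight (upd w e j) * (p e (w e) * f (upd (upd w e j) e (w e))))) /=.
apply: eq_bigr => w _.
under eq_bigr do rewrite upd_upd mulrA pweight_upd.
by rewrite -big_distrl /= -big_distrr /= p_sum1 mulr1.
Qed.

Definition lower_mass e (b : nat) : R := \sum_(j : 'I_M.+1 | (j <= b)%N) p e j.

Definition indep_of (X : Type) (F : {pred I}) (f : {ffun I -> 'I_M.+1} -> X) :=
  forall w e j, e \in F -> f (upd w e j) = f w.

(** The thresholds [b i] may be random: it is enough that they ignore the coordinates indexed by
    [s]. This is conditioning on the rest of the configuration, phrased without conditional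
    expectations. *)
Lemma Ex_coords (J : eqType) (s : seq J) (c : J -> I) f (b : J -> _ -> nat) :
  uniq s -> {in s &, injective c} ->
  indep_of [in map c s] f ->
  (forall i, i \in s -> indep_of [in map c s] (b i)) ->
  Ex (fun w => f w * \prod_(i <- s) (w (c i) <= b i w)%N%:R) =
  Ex (fun w => f w * \prod_(i <- s) lower_mass (c i) (b i w)).
Proof.
elim: s f => [|i s IHs] f /=.
  by move=> _ _ _ _; apply: Ex_ext => w; rewrite !big_nil.
move=> /andP[is_s us] cinj fF bF.
(* The mass of the head joins [f], so that the induction hypothesis handles the tail and a single
   coordinate remains to be resampled. *)
transitivity (Ex (fun w => (f w * lower_mass (c i) (b i w)) *
    \prod_(k <- s) (w (c k) <= b k w)%N%:R)); last first.
  rewrite IHs //.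
  - by apply: Ex_ext => w; rewrite big_cons mulrA.
  - by move=> x y xs ys; apply: cinj; rewrite inE ?xs ?ys orbT.
  - move=> w e j eF; have eF' : e \in map c (i :: s) by rewrite inE eF orbT.
    by rewrite fF // bF // inE eqxx.
  - move=> k ks w e j eF; have eF' : e \in map c (i :: s) by rewrite inE eF orbT.
    by rewrite bF // inE ks orbT.
rewrite (Ex_resample (c i)) [RHS](Ex_resample (c i)).
apply: Ex_ext => w.
have E1 j : f (upd w (c i) j) = f w by rewrite fF // inE eqxx.
have E2 k j : k \in i :: s -> b k (upd w (c i) j) = b k w.
  by move=> ks; rewrite bF // inE eqxx.
have E3 k j : k \in s -> upd w (c i) j (c k) = w (c k).
  move=> ks; rewrite ffunE; case: eqP => // /cinj E.
  by move: is_s; rewrite -E ?ks// !inE ?eqxx ?ks ?orbT.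
have E4 j : \prod_(k <- s) (upd w (c i) j (c k) <= b k (upd w (c i) j))%N%:R =
    \prod_(k <- s) (w (c k) <= b k w)%N%:R :> R.
  rewrite big_seq [RHS]big_seq; apply: eq_bigr => k ks.
  by rewrite E3 // E2 // inE ks orbT.
under eq_bigr do rewrite big_cons E1 E4 E2 ?inE ?eqxx // ffunE eqxx.
under [RHS]eq_bigr do rewrite E1 E4 E2 ?inE ?eqxx //.
rewrite -[RHS]big_distrl /= p_sum1 mul1r /lower_mass.
set P := \prod_(_ <- _) _.
rewrite [X in _ = _ * X * _]big_mkcond mulr_sumr mulr_suml; apply: eq_bigr => j _.
by case: ifP => _; rewrite ?mulr0 ?mul0r ?mulr0// mul1r mulrCA mulrA.
Qed.

Lemma Ex_markov f (c : R) : 0 < c -> (forall w, 0 <= f w) ->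
  Ex (fun w => (c <= f w)%R%:R) <= Ex f / c.
Proof.
move=> c0 f0; rewrite mulrC -ExZ; apply: ler_Ex => w.
case: (leP c (f w)) => [cf|_] /=; last by rewrite mulr_ge0 ?invr_ge0 ?(ltW c0).
by rewrite ler_pdivlMl // mulr1.
Qed.

End FiniteProduct.

(** * Matchings and gains *)

Section MatchingGain.
Local Open Scope nat_scope.
Variable n : nat.
Implicit Types (x y : 'I_n * 'I_n -> nat) (A B : {set 'I_n}) (m : {set 'I_n * 'I_n}).
Implicit Types (u v i : 'I_n).

Definition edge_of (u v : 'I_n) : 'I_n * 'I_n := if (u < v)%N then (u, v) else (v, u).

Lemma edge_ofC u v : edge_of u v = edge_of v u.
Proof.
rewrite /edge_of; case: ltngtP => //= uv.
by rewrite (val_inj uv).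
Qed.

Lemma edge_of_edge u v : u != v -> is_edge (edge_of u v).
Proof. by rewrite /is_edge /edge_of => uv; case: (ltngtP u v) uv => //= /val_inj ->; rewrite eqxx. Qed.

Lemma edge_of_is_edge e : is_edge e -> edge_of e.1 e.2 = e.
Proof. by case: e => u v; rewrite /is_edge /edge_of /= => ->. Qed.

Lemma edge_of_inj v u i : edge_of v u = edge_of v i -> u = i.
Proof. by rewrite /edge_of; case: ifP => _; case: ifP => _ [] // -> ->. Qed.

Lemma edge_of_eq a b u v : edge_of a b = edge_of u v -> (a == u) || (a == v).
Proof. by rewrite /edge_of; do 2![case: ifP => _] => -[*]; subst; rewrite eqxx ?orbT. Qed.

Definition inside A m := [forall e in m, (e.1 \in A) && (e.2 \in A)].

Definition max_weight x A : nat :=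
  \max_(m : {set 'I_n * 'I_n} | is_matching m && inside A m) \sum_(e in m) x e.

Definition gain x v A : nat := (max_weight x (v |: A) - max_weight x A)%N.

Fixpoint trunc_gain x (k : nat) v A : nat :=
  if k is k'.+1 then \max_(i in A) (x (edge_of v i) - trunc_gain x k' i (A :\ i)) else 0.

Lemma matchingP m : reflect ((forall e, e \in m -> is_edge e) /\
   forall e f, e \in m -> f \in m -> e != f -> vertex_disjoint e f) (is_matching m).
Proof.
apply: (iffP andP) => [[/forall_inP h1 /forall_inP h2]|[h1 h2]].
  split=> // e f em fm ef; have /forall_inP/(_ f fm)/implyP := h2 e em; exact.
split; first exact/forall_inP.
by apply/forall_inP => e em; apply/forall_inP => f fm; apply/implyP; exact: h2.
Qed.

Lemma insideP A m : reflect (forall e, e \in m -> (e.1 \in A) && (e.2 \in A)) (inside A m).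
Proof. exact: forall_inP. Qed.

Lemma is_matching0 : is_matching (finset.set0 : {set 'I_n * 'I_n}).
Proof. by apply/matchingP; split => [e|e f]; rewrite inE. Qed.

Lemma is_matchingS m m' : m' \subset m -> is_matching m -> is_matching m'.
Proof.
move=> /fintype.subsetP s /matchingP[h1 h2]; apply/matchingP; split=> [e /s|e f /s em /s fm].
  exact: h1.
exact: h2.
Qed.

Lemma max_weight_ge x A m : is_matching m -> inside A m -> \sum_(e in m) x e <= max_weight x A.
Proof.
move=> h1 h2; rewrite /max_weight.
by rewrite (@leq_bigmax_cond _ _ (fun m : {set 'I_n * 'I_n} => \sum_(e in m) x e)) ?h1.
Qed.

Lemma max_weight_ex x A : exists m, [/\ is_matching m, inside A m &
  max_weight x A = \sum_(e in m) x e].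
Proof.
have h0 : is_matching (finset.set0 : {set 'I_n * 'I_n}) && inside A finset.set0.
  by rewrite is_matching0; apply/insideP => e; rewrite inE.
rewrite /max_weight (bigop.bigmax_eq_arg finset.set0) //.
by case: arg_maxnP => // m /andP[h1 h2] _; exists m.
Qed.

Lemma max_weightS x A B : A \subset B -> max_weight x A <= max_weight x B.
Proof.
move=> /fintype.subsetP AB; have [m [h1 /insideP h2 ->]] := max_weight_ex x A.
apply: max_weight_ge => //; apply/insideP => e /h2 /andP[/AB -> /AB ->] //.
Qed.

Lemma max_weight_set0 x : max_weight x finset.set0 = 0.
Proof.
have [m [h1 /insideP h2 ->]] := max_weight_ex x finset.set0.
by rewrite big1 // => e /h2; rewrite inE.
Qed.

Lemma max_weight_add x A u v : u != v -> u \notin A -> v \notin A ->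
  x (edge_of u v) + max_weight x A <= max_weight x (u |: (v |: A)).
Proof.
move=> uv uA vA; have [m [/matchingP[h1 h3] /insideP h2 ->]] := max_weight_ex x A.
have em : edge_of u v \notin m.
  by apply/negP => /h2; rewrite /edge_of; case: ifP => _ /=; rewrite (negbTE uA) ?andbF.
rewrite -big_setU1 //=; apply: max_weight_ge.
  have dj f : f \in m -> vertex_disjoint (edge_of u v) f.
    move=> /h2 /andP[f1 f2]; rewrite /vertex_disjoint /edge_of.
    have nu w : w \in A -> u != w by apply: contraTneq => <-.
    have nv w : w \in A -> v != w by apply: contraTneq => <-.
    by case: ifP => _ /=; rewrite !nu ?nv.
  have vdC (e f : 'I_n * 'I_n) : vertex_disjoint e f = vertex_disjoint f e.
    rewrite /vertex_disjoint ![f.1 == _]eq_sym ![f.2 == _]eq_sym.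
    by do 4![case: eqP => //= _].
  apply/matchingP; split=> [e|e f].
    by rewrite !inE => /orP[/eqP ->|/h1//]; exact: edge_of_edge.
  rewrite !inE => /orP[/eqP ->|em'] /orP[/eqP ->|fm].
  - by rewrite eqxx.
  - by move=> _; exact: dj.
  - by move=> _; rewrite vdC; exact: dj.
  - exact: h3.
apply/insideP => e; rewrite !inE => /orP[/eqP ->|/h2 /andP[-> ->]]; last by rewrite !orbT.
by rewrite /edge_of; case: ifP => _ /=; rewrite !eqxx ?orbT.
Qed.

Lemma max_weight_rec x v A : v \notin A ->
  max_weight x (v |: A) =
  maxn (max_weight x A) (\max_(i in A) (x (edge_of v i) + max_weight x (A :\ i))).
Proof.
move=> vA; apply/eqP; rewrite eqn_leq; apply/andP; split; last first.
  rewrite geq_max max_weightS ?finset.subsetUr //=; apply/bigmax_leqP => i iA.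
  have vi : v != i by apply: contraNneq vA => ->.
  rewrite -{2}(finset.setD1K iA) max_weight_add // ?inE ?eqxx //=.
  by rewrite negb_and vA orbT.
have [m [mm /insideP h2 ->]] := max_weight_ex x (v |: A).
have [h1 h3] := matchingP _ mm.
have [/existsP[e /andP[em ve]]|] := boolP [exists e in m, (v == e.1) || (v == e.2)]; last first.
  rewrite negb_exists => /forallP nv; rewrite leq_max; apply/orP; left.
  apply: max_weight_ge => //; apply/insideP => e em.
  have := nv e; rewrite em /= negb_or => /andP[n1 n2].
  by have := h2 e em; rewrite !inE !(eq_sym _ v) (negbTE n1) (negbTE n2).
have ee := h1 e em.
pose i := if v == e.1 then e.2 else e.1.
have e12 : e.1 != e.2 by apply: contraTneq ee => E; rewrite /is_edge E ltnn.
have vi : v != i.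
  by rewrite /i; case: (v =P e.1) => [->|/eqP].
have ev : edge_of v i = e.
  rewrite /i; case: eqP ve => [-> _|_ /= /eqP ->]; first exact: edge_of_is_edge.
  by rewrite edge_ofC edge_of_is_edge.
have iA : i \in A.
  have := h2 e em; rewrite !inE /i; case: (v =P e.1) => [->|/eqP n1].
    by rewrite ?eqxx [e.2 == _]eq_sym (negbTE e12).
  by rewrite eq_sym (negbTE n1) => /andP[].
rewrite leq_max; apply/orP; right.
apply: leq_trans (leq_bigmax_cond _ iA); rewrite (bigD1 e) //= ev leq_add2l.
rewrite (eq_bigl (mem (m :\ e))); last by move=> f; rewrite !inE andbC.
apply: max_weight_ge; first exact: is_matchingS (subD1set _ _) mm.
apply/insideP => f; rewrite !inE => /andP[fe fm].
have := h3 e f em fm; rewrite eq_sym => /(_ fe) /and4P[d1 d2 d3 d4].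
have := h2 f fm; rewrite !inE.
have nv w : e.1 != w -> e.2 != w -> (w != v) && (w != i).
  rewrite ![_ == w]eq_sym /i.
  by case: (v =P e.1) ve => [-> _|_ /= /eqP ->] -> ->.
have /andP[/negbTE -> ->] := nv f.1 d1 d3.
by have /andP[/negbTE -> ->] := nv f.2 d2 d4.
Qed.

(** Giving [v] the partner [i] earns the edge and forfeits what [i] contributed to [A], which is
    [gain x i (A :\ i)]. Leaving [v] unmatched is accounted for by the subtraction in [nat], which
    stops at 0. *)
Lemma gain_rec x v A : v \notin A ->
  gain x v A = \max_(i in A) (x (edge_of v i) - gain x i (A :\ i)).
Proof.
move=> vA; rewrite /gain max_weight_rec // maxnE addKn.
have sub (b : nat) (F : 'I_n -> nat) :
    \max_(i in A) F i - b = \max_(i in A) (F i - b).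
  by apply: (big_morph (subn^~ b)) => [p q|] /=; lia.
rewrite sub; apply: eq_bigr => i iA; rewrite finset.setD1K //.
have := max_weightS x (subD1set A i); lia.
Qed.

(** Each unfolding subtracts the deeper value and so reverses the comparison, which starts from
    [0 <= gain x v A]. *)
Lemma trunc_gain_odd_even x k v A : v \notin A ->
  if odd k then gain x v A <= trunc_gain x k v A else trunc_gain x k v A <= gain x v A.
Proof.
elim: k v A => [|k IHk] v A vA //=.
rewrite gain_rec //; case: (odd k) IHk => /= IHk.
  apply/bigmax_leqP => i iA; apply: leq_trans (leq_bigmax_cond _ iA).
  by apply: leq_sub2l; apply: IHk; rewrite !inE eqxx.
apply/bigmax_leqP => i iA; apply: leq_trans (leq_bigmax_cond _ iA).
by apply: leq_sub2l; apply: IHk; rewrite !inE eqxx.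
Qed.

Definition below (j : nat) : {set 'I_n} := [set i : 'I_n | (i < j)%N]%SET.

Lemma below_notin (j : 'I_n) : j \notin below j.
Proof. by rewrite inE ltnn. Qed.

Lemma card_below (j : 'I_n) : #|below j| = j.
Proof.
rewrite -sum1_card (eq_bigl (fun i : 'I_n => i < j)); last by move=> i; rewrite inE.
by rewrite -(big_ord_widen n (fun=> 1)) 1?ltnW // sum1_card card_ord.
Qed.

(** Inserting the vertices in increasing order telescopes the weight. The price is that graphs of
    every size [j < n] occur, hence every ratio [j / N] in the limit. *)
Lemma max_weight_sum x :
  max_weight x finset.setT = \sum_(j < n) gain x j (below j).
Proof.
have H (k : nat) : k <= n -> max_weight x (below k) = \sum_(j < n | j < k) gain x j (below j).
  elim: k => [_|k IHk kn].
    have -> : below 0 = finset.set0 by apply/finset.setP => i; rewrite !inE.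
    by rewrite max_weight_set0 big_pred0.
  rewrite (bigD1 (Ordinal kn)) //= (eq_bigl (fun j : 'I_n => j < k)); last first.
    by move=> j /=; rewrite -val_eqE /= ltnS ltn_neqAle andbC.
  rewrite -IHk 1?ltnW // /gain.
  have <- : below k.+1 = Ordinal kn |: below k.
    by apply/finset.setP => i; rewrite !inE ltnS leq_eqVlt.
  by rewrite subnK // max_weightS //; apply/fintype.subsetP => i; rewrite !inE => /leqW.
rewrite -[in RHS](eq_bigl _ _ (fun j : 'I_n => ltn_ord j)) -H //.
by congr max_weight; apply/finset.setP => i; rewrite !inE ltn_ord.
Qed.

(** A gain only looks at edges within [v |: A]; the independence statements about gains rest on
    this. *)
Lemma trunc_gain_ext x y k v A : v \notin A ->
  (forall a b, a \in v |: A -> b \in v |: A -> a != b -> x (edge_of a b) = y (edge_of a b)) ->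
  trunc_gain x k v A = trunc_gain y k v A.
Proof.
elim: k v A => [|k IHk] v A vA xy //=; apply: eq_bigr => i iA.
rewrite xy ?inE ?eqxx ?iA ?orbT //; last by apply: contraNneq vA => ->.
congr (_ - _); apply: IHk => [|a b]; first by rewrite !inE eqxx.
by rewrite finset.setD1K // => aA bA; apply: xy; rewrite inE ?aA ?bA orbT.
Qed.

Lemma trunc_gain_le x (M k : nat) v A : (forall e, x e <= M) -> trunc_gain x k v A <= M.
Proof.
by move=> xM; case: k => [|k] //=; apply/bigmax_leqP => i _; exact: leq_trans (leq_subr _ _) (xM _).
Qed.

End MatchingGain.

(** * Concentration of the truncated gains *)

Section RealFacts.
Variable R : realType.
Implicit Types a b : R.

Lemma expRN_lipschitz a b : 0 <= a -> 0 <= b ->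
  `|expR (- a) - expR (- b)| <= `|a - b|.
Proof.
wlog ab : a b / a <= b => [H a0 b0|a0 b0].
  have [ab|/ltW ba] := leP a b; first exact: H.
  by rewrite distrC [leRHS]distrC; exact: H.
have -> : expR (- b) = expR (- a) * expR (- (b - a)) by rewrite -expRD; congr expR; ring.
have e1 : expR (- a) <= 1 by rewrite -expR0 ler_expR; lra.
have e2 := expR_gt0 (- a).
have e3 : 1 - (b - a) <= expR (- (b - a)) by have := expR_ge1Dx (- (b - a)).
have e4 : expR (- (b - a)) <= 1 by rewrite -expR0 ler_expR; lra.
rewrite ger0_norm; last by nra.
by rewrite distrC ger0_norm; nra.
Qed.

Lemma sqr_sum_le (m : nat) (a : 'I_m -> R) :
  (\sum_i a i) ^+ 2 <= m%:R * \sum_i a i ^+ 2.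
Proof.
have -> : m%:R * \sum_i a i ^+ 2 =
    \sum_(i < m) \sum_(j < m) a i ^+ 2 / 2 + \sum_(i < m) \sum_(j < m) a j ^+ 2 / 2.
  rewrite [X in _ + X]exchange_big /= -mulr2n; set S := \sum_(i < m) \sum_(j < m) _.
  have -> : S = m%:R * (\sum_i a i ^+ 2 / 2).
    by rewrite mulr_sumr; apply: eq_bigr => i _; rewrite sumr_const card_ord mulr_natl.
  by rewrite -mulr_suml -mulrnAr -[_ / 2 *+ 2]mulr_natr divfK ?pnatr_eq0.
rewrite -big_split expr2 mulr_suml; apply: ler_sum => i _.
rewrite mulr_sumr -big_split; apply: ler_sum => j _ /=.
by rewrite -mulrDl ler_pdivlMr // mulr_natr -subr_ge0 addrAC -sqrrB sqr_ge0.
Qed.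

Lemma sum_le_card (I : finType) (P : pred I) (F : I -> R) (c : R) :
  (forall i, P i -> F i <= c) -> \sum_(i | P i) F i <= #|P|%:R * c.
Proof.
move=> H; apply: (@le_trans _ _ (\sum_(i | P i) c)); first exact: ler_sum.
by rewrite sumr_const mulr_natl.
Qed.

Lemma nat_layers (M a : nat) : (a <= M)%N ->
  a%:R = \sum_(q < M) (1 - (a <= q)%N%:R) :> R.
Proof.
move=> aM; have -> : a = minn a M by lia.
elim: M {aM} => [|M IHM]; first by rewrite minn0 big_ord0.
rewrite big_ord_recr /=; have [MA|AM] := leqP M.+1 a.
  have Mn : minn a M = M by lia.
  rewrite Mn in IHM; rewrite (eq_bigr (fun q : 'I_M => 1 - (M <= q)%N%:R)); last first.
    by move=> q _; rewrite [(M <= q)%N]leqNgt ltn_ord ltnNge ltnW.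
  by rewrite -IHM ltnn subr0 -natr1.
have Mn : minn a M = a by lia.
by rewrite Mn in IHM; rewrite -IHM -ltnS AM subrr addr0.
Qed.

End RealFacts.

(** * The limiting recursion for the law of the truncated gains *)

Section Limit.
Variables (R : realType) (M : nat) (phi : nat -> R).
Hypothesis phi0 : phi 0%N = 0.
Hypothesis phi_homo : {homo phi : a b / (a <= b)%N >-> a <= b}.

Definition kap (m : nat) : R := phi m - phi m.-1.

(* [plim s k q] is the limiting probability that the depth-[k] gain of a vertex in a
   graph with [s * N] vertices is at most [q], when edges exceed level [M - b] with
   probability [1 - expR (- (phi b / N))]; [xlim] is the corresponding mean. *)
Fixpoint plim (s : R) (k q : nat) : R :=
  if k is k'.+1 then expR (- (s * \sum_(r < M) kap (M - q - r) * plim s k' r)) else 1.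

Definition xlim (s : R) (k : nat) : R := \sum_(q < M) (1 - plim s k q).

Lemma phi_ge0 m : 0 <= phi m.
Proof. by rewrite -phi0 phi_homo. Qed.

Lemma kap_ge0 m : 0 <= kap m.
Proof. by rewrite subr_ge0 phi_homo ?leq_pred. Qed.

(** Summation by parts in the threshold. It makes [phi (M - q - g)] linear in the indicators
    [g <= r], so that averaging over vertices involves only the empirical distribution of the gains
    and the recursion for [plim] closes. *)
Lemma phi_layers (q g : nat) :
  phi (M - q - g) = \sum_(r < M) kap (M - q - r) * (g <= r)%N%:R.
Proof.
pose F r := - phi (M - q - maxn g r).
have H (r : nat) : kap (M - q - r) * (g <= r)%N%:R = F r.+1 - F r.
  rewrite /F /kap; case: leqP => gr; rewrite ?mulr1 ?mulr0.
    have -> : maxn g r.+1 = r.+1 by lia.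
    by rewrite opprK addrC subnS.
  have -> : maxn g r.+1 = g by lia.
  by rewrite subrr.
under eq_bigr do rewrite H.
rewrite -(big_mkord xpredT (fun r => F r.+1 - F r)) telescope_sumr //.
rewrite /F maxn0 opprK (_ : (M - q - maxn g M)%N = 0%N); last by lia.
by rewrite phi0 oppr0 add0r.
Qed.

Lemma sum_kap q : \sum_(r < M) kap (M - q - r) = phi (M - q).
Proof. by rewrite -[(M - q)%N in RHS]subn0 phi_layers; apply: eq_bigr => r _; rewrite mulr1. Qed.

Lemma plim_gt0 s k q : 0 < plim s k q.
Proof. by case: k => [|k] /=; rewrite ?ltr01 ?expR_gt0. Qed.

Lemma sum_kap_plim_ge0 s k q : 0 <= \sum_(r < M) kap (M - q - r) * plim s k r.
Proof. by apply: sumr_ge0 => r _; rewrite mulr_ge0 ?kap_ge0 ?ltW ?plim_gt0. Qed.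

Lemma plim_le1 s k q : 0 <= s -> plim s k q <= 1.
Proof.
case: k => [|k] //= s0; rewrite -[leRHS]expR0 ler_expR oppr_le0.
by rewrite mulr_ge0 ?sum_kap_plim_ge0.
Qed.

Lemma sum_kap_le q (a : nat -> R) (c : R) : 0 <= c -> (forall r, a r <= c) ->
  \sum_(r < M) kap (M - q - r) * a r <= phi M * c.
Proof.
move=> c0 ac; apply: (@le_trans _ _ (phi (M - q) * c)); last first.
  by rewrite ler_wpM2r // phi_homo ?leq_subr.
by rewrite -sum_kap mulr_suml; apply: ler_sum => r _; rewrite ler_wpM2l ?kap_ge0.
Qed.

(** It serves twice: as a Lipschitz constant of [plim] in [s] and, divided by [N], as a bound on the
    probability that deleting a vertex changes a gain of depth [k]. In both, the factor 2 bounds the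
    ratio of the number of vertices to [N]. *)
Fixpoint dep_cst (k : nat) : R := if k is k'.+1 then phi M + 2 * phi M * dep_cst k' else 0.

Lemma dep_cst_ge0 k : 0 <= dep_cst k.
Proof. by elim: k => //= k IHk; rewrite addr_ge0 ?mulr_ge0 ?phi_ge0. Qed.

Lemma plim_lipschitz s s' k q : 0 <= s <= 2 -> 0 <= s' <= 2 ->
  `|plim s k q - plim s' k q| <= dep_cst k * `|s - s'|.
Proof.
move=> /andP[s0 s2] /andP[s'0 s'2]; elim: k q => [|k IHk] q /=.
  by rewrite subrr normr0 mul0r.
apply: (le_trans (expRN_lipschitz _ _)); rewrite ?mulr_ge0 ?sum_kap_plim_ge0 //.
set a := \sum_(r < M) _; set b := \sum_(r < M) _.
have -> : s * a - s' * b = (s - s') * a + s' * (a - b) by ring.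
apply: (le_trans (ler_normD _ _)); rewrite !normrM mulrDl.
have a0 : 0 <= a by exact: sum_kap_plim_ge0.
apply: lerD.
  rewrite mulrC ler_wpM2r // ger0_norm // -[leRHS]mulr1.
  by apply: sum_kap_le => // r; exact: plim_le1.
rewrite (ger0_norm s'0) -!mulrA; apply: ler_pM => //.
rewrite /a /b -sumrB; apply: (le_trans (ler_norm_sum _ _ _)).
under eq_bigr do rewrite -mulrBr normrM (ger0_norm (kap_ge0 _)).
by apply: (@sum_kap_le q (fun r => `|plim s k r - plim s' k r|)) => //; rewrite mulr_ge0 ?dep_cst_ge0.
Qed.

Definition dev_bound (c : R) : R := M%:R ^+ 2 * phi M ^+ 2 * c.

(** Write [K] for [dep_cst k] and [B] for the [dev_bound] term. The centred indicators of two
    distinct vertices have a product of mean at most [(6 * K + 2 * B) / N]; with at most [2 * N]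
    vertices the pairs contribute [24 * K + 8 * B] and the diagonal 2. *)
Fixpoint conc_cst (k : nat) : R :=
  if k is k'.+1 then 2 + 24 * dep_cst k + 8 * dev_bound (conc_cst k') else 0.

Lemma dev_bound_ge0 c : 0 <= c -> 0 <= dev_bound c.
Proof. by move=> c0; rewrite !mulr_ge0 ?exprn_ge0 ?phi_ge0. Qed.

Lemma conc_cst_ge0 k : 0 <= conc_cst k.
Proof. elim: k => //= k IHk; have := dep_cst_ge0 k.+1; have := dev_bound_ge0 IHk => /=; lra.
Qed.

End Limit.

(** * Second moments of truncated gains for independent levels *)

Section Model.
Variables (R : realType) (M : nat) (phi : nat -> R).
Hypothesis phi0 : phi 0%N = 0.
Hypothesis phi_homo : {homo phi : a b / (a <= b)%N >-> a <= b}.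
Variables (n : nat) (N : R) (p : 'I_n * 'I_n -> 'I_M.+1 -> R).
Hypothesis N_ge1 : 1 <= N.
Hypothesis p_ge0 : forall e j, 0 <= p e j.
Hypothesis p_sum1 : forall e, \sum_j p e j = 1.
Hypothesis p_cdf : forall e b, is_edge e -> lower_mass p e b = expR (- (phi (M - b) / N)).

Local Notation Om := {ffun 'I_n * 'I_n -> 'I_M.+1}.
Local Notation E := (Ex p).
Implicit Types (w : Om) (A : {set 'I_n}) (u v i : 'I_n).

Definition levels w : 'I_n * 'I_n -> nat := fun e => w e.

Local Notation tg k v A w := (trunc_gain (levels w) k v A).

Let N_gt0 : 0 < N. Proof. exact: lt_le_trans ltr01 N_ge1. Qed.

Definition star u A : pred ('I_n * 'I_n) := [in map (edge_of u) (enum A)].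

Definition load k A q w : R := (\sum_(i in A) phi (M - q - tg k i (A :\ i) w)) / N.

Lemma load_ge0 k A q w : 0 <= load k A q w.
Proof. by rewrite divr_ge0 ?(ltW N_gt0) // sumr_ge0 // => i _; exact: phi_ge0. Qed.

Lemma trunc_gain_indep k u v A B : u \notin v |: A -> v \notin A ->
  indep_of (star u B) (fun w => tg k v A w).
Proof.
move=> uA vA w e j /mapP[i _ ->]; apply: trunc_gain_ext => // a b aA bA ab.
rewrite /levels ffunE; case: eqP => // /esym/edge_of_eq /orP[] /eqP E; move: uA; rewrite E ?aA ?bA.
  by [].
by [].
Qed.

Lemma indep_load k u A q B : u \notin A -> indep_of (star u B) (load k A q).
Proof.
move=> uA w e j eB; rewrite /load; congr (_ / _); apply: eq_bigr => i iA.
by rewrite (@trunc_gain_indep k u i (A :\ i) B) ?finset.setD1K ?finset.setD11.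
Qed.

Lemma trunc_gainS_le k v A q w : (tg k.+1 v A w <= q)%N =
  all (fun i => (w (edge_of v i) <= q + tg k i (A :\ i) w)%N) (enum A).
Proof.
apply/bigmax_leqP/allP => [H i|H i iA].
  by rewrite mem_enum => /H; rewrite leq_subLR addnC.
by rewrite leq_subLR addnC H // mem_enum.
Qed.

(** The deeper gains live inside [A], so they are independent of the edges from [v] to [A];
    integrating these edges out gives a product of exponentials whose exponents add up to the
    [load]. The factor [f] carries whatever else is conditioned on. *)
Lemma Ex_cond k v A q (f : Om -> R) : v \notin A -> indep_of (star v A) f ->
  E (fun w => f w * (tg k.+1 v A w <= q)%N%:R) = E (fun w => f w * expR (- load k A q w)).
Proof.
move=> vA fA.
have cnt (s : seq 'I_n) (P : pred 'I_n) : (all P s)%:R = \prod_(i <- s) (P i)%:R :> R.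
  elim: s => [|i s IHs] /=; first by rewrite big_nil.
  by rewrite big_cons -IHs -natrM mulnb.
under Ex_ext do rewrite trunc_gainS_le cnt.
have H := @Ex_coords R _ M p p_sum1 _ (enum A) (edge_of v) f
  (fun i w => (q + tg k i (A :\ i) w)%N).
rewrite H ?enum_uniq //; last 2 first.
- by move=> i j _ _; exact: edge_of_inj.
- move=> i; rewrite mem_enum => iA w e j eA.
  by rewrite (@trunc_gain_indep k v i (A :\ i) A) ?finset.setD1K ?finset.setD11.
apply: Ex_ext => w; congr (_ * _).
rewrite /load mulr_suml -sumrN expR_sum big_enum /=; apply: eq_bigr => i iA.
rewrite p_cdf ?subnDA //; apply: edge_of_edge.
by apply: contraNneq vA => ->.
Qed.

Lemma Ex_cond_sub k v A q (c : R) (f : Om -> R) : v \notin A -> indep_of (star v A) f ->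
  E (fun w => f w * ((tg k.+1 v A w <= q)%N%:R - c)) =
  E (fun w => f w * (expR (- load k A q w) - c)).
Proof.
move=> vA fA.
under Ex_ext do rewrite mulrBr; under [RHS]Ex_ext do rewrite mulrBr.
by rewrite !ExB Ex_cond.
Qed.

Lemma Ex_edge_gt0 v i (f : Om -> R) : v != i -> (forall w, 0 <= f w) ->
  indep_of [in [:: edge_of v i]] f ->
  E (fun w => f w * (0 < w (edge_of v i))%N%:R) <= phi M / N * E f.
Proof.
move=> vi f0 fi.
have H := @Ex_coords R _ M p p_sum1 _ [:: i] (edge_of v) f (fun _ _ => 0%N).
have {}H : E (fun w => f w * (w (edge_of v i) <= 0)%N%:R) =
    lower_mass p (edge_of v i) 0 * E f.
  rewrite -ExZ; under [RHS]Ex_ext do rewrite GRing.mulrC.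
  have := H isT (fun a b _ _ => @edge_of_inj n v a b) fi (fun _ _ _ _ _ _ => erefl).
  under Ex_ext do rewrite big_seq1; under [X in _ = X -> _]Ex_ext do rewrite big_seq1.
  by [].
have -> : E (fun w => f w * (0 < w (edge_of v i))%N%:R) =
    E f - E (fun w => f w * (w (edge_of v i) <= 0)%N%:R).
  rewrite -ExB; apply: Ex_ext => w; rewrite lt0n leqn0.
  by case: (_ == _); rewrite /= ?mulr1 ?mulr0 ?subrr ?subr0.
rewrite H p_cdf ?edge_of_edge // subn0 -[X in X - _]mul1r -mulrBl.
rewrite ler_wpM2r ?Ex_ge0 // lerBlDr -lerBlDl.
by have := expR_ge1Dx (- (phi M / N)).
Qed.

(** An edge of level 0 contributes nothing to the maximum, so a change of gain must propagate along
    an edge of positive level. *)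
Lemma trunc_gain_remove k v u A w : v \notin A ->
  tg k.+1 v A w != tg k.+1 v (A :\ u) w ->
  (u \in A) && (0 < w (edge_of v u))%N \/
  exists2 i, i \in A :\ u & (0 < w (edge_of v i))%N &&
    (tg k i (A :\ i) w != tg k i (A :\ u :\ i) w).
Proof.
move=> vA; apply: contraNP => /not_orP[/negP nu /forall2NP ni]; apply/eqP => /=.
have H : \max_(i in A :\ u) (levels w (edge_of v i) - tg k i (A :\ i) w)%N =
    \max_(i in A :\ u) (levels w (edge_of v i) - tg k i (A :\ u :\ i) w)%N.
  apply: eq_bigr => i iA; case: (ni i) => // /negP; rewrite negb_and -eqn0Ngt negbK /levels.
  by case/orP => /eqP ->.
case: (boolP (u \in A)) nu => [uA|uA _] /=; last first.
  rewrite -H; apply: eq_bigl => i; rewrite !inE andb_idl // => iA.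
  by apply: contraNneq uA => <-.
rewrite -eqn0Ngt => /eqP nu; rewrite (bigD1 u) //= /levels nu sub0n max0n -H.
by apply: eq_bigl => i; rewrite !inE andbC.
Qed.

(** Union bound over the first edge along which the change propagates: it has positive level with
    probability at most [phi M / N], independently of the deeper event, and there are at most
    [2 * N] choices. *)
Lemma Ex_remove k v u A : v \notin A -> #|A|%:R <= 2 * N ->
  E (fun w => (tg k v A w != tg k v (A :\ u) w)%:R) <= dep_cst M phi k / N.
Proof.
elim: k v A => [|k IHk] v A vA A2N.
  by rewrite /= mul0r -(Ex_cst p_sum1 0); apply: ler_Ex => // w; rewrite /= eqxx.
have neq i : i \in A -> v != i by move=> iA; apply: contraNneq vA => ->.
pose B i w : R := (tg k i (A :\ i) w != tg k i (A :\ u :\ i) w)%:R.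
have BE i : i \in A :\ u -> E (B i) <= dep_cst M phi k / N.
  move=> iA; rewrite /B.
  have -> : A :\ u :\ i = A :\ i :\ u by apply/finset.setP => j; rewrite !inE andbCA.
  apply: IHk; first by rewrite !inE eqxx.
  by apply: le_trans A2N; rewrite ler_nat subset_leq_card // subD1set.
apply: (@le_trans _ _ (E (fun w => (u \in A)%:R * (0 < w (edge_of v u))%N%:R +
    \sum_(i in A :\ u) B i w * (0 < w (edge_of v i))%N%:R))).
  apply: ler_Ex => // w; case: (boolP (_ != _)) => [|_]; last first.
    by rewrite addr_ge0 ?mulr_ge0 // sumr_ge0 // => i _; rewrite mulr_ge0 // /B.
  case/(trunc_gain_remove vA) => [/andP[-> ->]|[i iA /andP[i0 iB]]].
    by rewrite mulr1 lerDl sumr_ge0 // => i _; rewrite mulr_ge0 // /B.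
  rewrite (bigD1 i) //= /B i0 iB mulr1 addrCA lerDl addr_ge0 ?mulr_ge0 //.
  by rewrite sumr_ge0 // => j _; rewrite mulr_ge0.
rewrite ExD Ex_sum mulrDl; apply: lerD.
  case: (boolP (u \in A)) => [uA|_]; last first.
    under Ex_ext do rewrite mul0r.
    rewrite Ex_cst //.
    by rewrite divr_ge0 ?(ltW N_gt0) ?phi_ge0.
  apply: le_trans (@Ex_edge_gt0 v u (fun=> 1) _ _ _) _ => //; first exact: neq.
  by rewrite Ex_cst // mulr1.
apply: (@le_trans _ _ (\sum_(i in A :\ u) phi M / N * (dep_cst M phi k / N))).
  apply: ler_sum => i iA; have [iu iA'] := setD1P iA.
  apply: le_trans (@Ex_edge_gt0 v i (B i) _ _ _) _ => //; first exact: neq.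
    move=> w e j; rewrite inE => /eqP ->; rewrite /B.
    have vi : edge_of v i \in star v A by apply/mapP; exists i; rewrite ?mem_enum.
    rewrite (@trunc_gain_indep k v i (A :\ i) A) ?finset.setD1K ?finset.setD11 //.
    rewrite (@trunc_gain_indep k v i (A :\ u :\ i) A) ?finset.setD1K ?finset.setD11 //.
    by rewrite !inE negb_and vA orbT.
  by rewrite ler_wpM2l ?BE // divr_ge0 ?(ltW N_gt0) ?phi_ge0.
rewrite sumr_const -[_ *+ _]mulr_natl.
have cA : #|A :\ u|%:R <= 2 * N.
  by apply: le_trans A2N; rewrite ler_nat subset_leq_card // subD1set.
have -> : 2 * phi M * dep_cst M phi k / N = 2 * N * (phi M / N * (dep_cst M phi k / N)).
  by field; rewrite gt_eqF.
apply: ler_wpM2r => //; apply: mulr_ge0; apply: divr_ge0; rewrite ?(ltW N_gt0) //.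
  exact: phi_ge0.
exact: dep_cst_ge0.
Qed.

Definition dev k A q w : R :=
  (\sum_(i in A) (tg k i (A :\ i) w <= q)%N%:R) / N - #|A|%:R / N * plim M phi (#|A|%:R / N) k q.

Lemma load_dev k A q w :
  load k A q w - #|A|%:R / N * \sum_(r < M) kap phi (M - q - r) * plim M phi (#|A|%:R / N) k r =
  \sum_(r < M) kap phi (M - q - r) * dev k A r w.
Proof.
rewrite /load /dev; under eq_bigr do rewrite (phi_layers M phi0).
rewrite exchange_big /= mulr_suml mulr_sumr -sumrB; apply: eq_bigr => r _.
by rewrite mulrBr -mulr_sumr -mulrA; congr (_ - _); rewrite mulrCA.
Qed.

Lemma sqr_expR_load_le k A q w :
  (expR (- load k A q w) - plim M phi (#|A|%:R / N) k.+1 q) ^+ 2 <=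
  M%:R * phi M ^+ 2 * \sum_(r < M) dev k A r w ^+ 2.
Proof.
have s0 : 0 <= #|A|%:R / N by rewrite divr_ge0 // ltW.
apply: (@le_trans _ _ ((\sum_(r < M) kap phi (M - q - r) * dev k A r w) ^+ 2)).
  rewrite -load_dev -[leLHS]real_normK ?num_real // -[leRHS]real_normK ?num_real //.
  rewrite lerXn2r ?nnegrE //=; apply: expRN_lipschitz; first exact: load_ge0.
  by rewrite mulr_ge0 // sum_kap_plim_ge0.
apply: (le_trans (sqr_sum_le _)); rewrite -mulrA ler_wpM2l // mulr_sumr.
apply: ler_sum => r _; rewrite exprMn ler_wpM2r ?sqr_ge0 // lerXn2r ?nnegrE ?kap_ge0 ?phi_ge0 //.
rewrite /kap lerBlDr; apply: ler_wpDr; first exact: phi_ge0.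
by apply: phi_homo; rewrite -subnDA leq_subr.
Qed.

Lemma Ex_sqr_expR_load k A q c : (forall r, (r < M)%N -> E (fun w => dev k A r w ^+ 2) <= c / N) ->
  E (fun w => (expR (- load k A q w) - plim M phi (#|A|%:R / N) k.+1 q) ^+ 2) <=
  dev_bound M phi c / N.
Proof.
move=> H; apply: (le_trans (ler_Ex p_ge0 (sqr_expR_load_le k A q))).
rewrite ExZ Ex_sum.
have S : \sum_(r < M) E (fun w => dev k A r w ^+ 2) <= M%:R * (c / N).
  rewrite -[X in X%:R * _](card_ord M); apply: (@sum_le_card _ _ xpredT) => r _.
  exact: H.
apply: le_trans (ler_wpM2l _ S) _; first by rewrite mulr_ge0 ?exprn_ge0 // phi_ge0.
by rewrite /dev_bound le_eqVlt; apply/orP; left; apply/eqP; field; rewrite gt_eqF.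
Qed.

(** The gains of [u] and [v] in [A] use disjoint stars: given the edges inside [A] they are
    independent with the same law, whence the square. *)
Lemma Ex_pair k u v A q (c : R) : u \notin A -> v \notin A -> u != v ->
  E (fun w => ((tg k.+1 u A w <= q)%N%:R - c) * ((tg k.+1 v A w <= q)%N%:R - c)) =
  E (fun w => (expR (- load k A q w) - c) ^+ 2).
Proof.
move=> uA vA uv; rewrite Ex_cond_sub //; last first.
  move=> w e j eA; rewrite (@trunc_gain_indep k.+1 v u A A) //.
  by rewrite !inE negb_or eq_sym uv.
under Ex_ext do rewrite GRing.mulrC.
by rewrite Ex_cond_sub //; move=> w e j eA; rewrite (@indep_load k u A q A).
Qed.

Lemma norm_ind_sub_le1 (b : bool) (c : R) : 0 <= c <= 1 -> `|b%:R - c| <= 1.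
Proof. by move=> /andP[c0 c1]; rewrite ler_norml; case: b => /=; lra. Qed.

Lemma norm_ind_sub_prod (b b' d d' : bool) (c : R) : 0 <= c <= 1 ->
  (b%:R - c) * (d%:R - c) <= (b'%:R - c) * (d'%:R - c) + (b != b')%:R + (d != d')%:R.
Proof. by move=> /andP[c0 c1]; case: b; case: b'; case: d; case: d' => /=; nra. Qed.

(** In a pair [i], [j], each gain is computed in a graph containing the other vertex. Deleting that
    vertex costs a probability [K / N] per gain, and the centre moves from [c] to [c']. In the
    common graph [A'] the pair is conditionally independent, and what remains is the fluctuation of
    [load] one level down. *)
Lemma Ex_dev k A q : #|A|%:R <= 2 * N -> (q < M)%N ->
  E (fun w => dev k A q w ^+ 2) <= conc_cst M phi k / N.
Proof.
elim: k A q => [|k IHk] A q A2N qM.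
  rewrite mul0r -(Ex_cst p_sum1 0); apply: ler_Ex => // w.
  by rewrite /dev /= sumr_const mulr1 -mulr_natr mul1r subrr expr0n.
set s := #|A|%:R / N; set c := plim M phi s k.+1 q.
have s0 : 0 <= s by rewrite divr_ge0 // ltW.
have s2 : s <= 2 by rewrite ler_pdivrMr.
have c01 : 0 <= c <= 1 by rewrite ltW ?plim_gt0 // plim_le1.
pose Y i w : R := (tg k.+1 i (A :\ i) w <= q)%N%:R - c.
have devE w : dev k.+1 A q w = (\sum_(i in A) Y i w) / N.
  by rewrite /dev -/s -/c /Y sumrB sumr_const mulrBl -mulr_natl mulrAC.
pose K := dep_cst M phi k.+1; pose B := dev_bound M phi (conc_cst M phi k).
have K0 : 0 <= K by exact: dep_cst_ge0.
have B0 : 0 <= B by apply: dev_bound_ge0 => //; exact: conc_cst_ge0.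
have off i j : i \in A -> j \in A -> i != j ->
    E (fun w => Y i w * Y j w) <= (6 * K + 2 * B) / N.
  move=> iA jA ij; set A' := A :\ i :\ j.
  have A'E : A' = A :\ j :\ i by apply/finset.setP => x; rewrite !inE andbCA.
  have iA' : i \notin A' by rewrite !inE eqxx andbF.
  have jA' : j \notin A' by rewrite !inE eqxx.
  have cA' : (#|A'| + 2 = #|A|)%N.
    by rewrite (cardsD1 i A) iA (cardsD1 j (A :\ i)) !inE eq_sym ij jA /= -/A' addnA addnC.
  have A'2N : #|A'|%:R <= 2 * N by apply: le_trans A2N; rewrite ler_nat -cA' leq_addr.
  set s' := #|A'|%:R / N; set c' := plim M phi s' k.+1 q.
  have s'0 : 0 <= s' by rewrite divr_ge0 // ltW.
  have s'2 : s' <= 2 by rewrite ler_pdivrMr.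
  have c'01 : 0 <= c' <= 1 by rewrite ltW ?plim_gt0 // plim_le1.
  have cc' : (c' - c) ^+ 2 <= K * (2 / N).
    have h1 : `|c' - c| <= K * (2 / N).
      have -> : 2 / N = `|s' - s|.
        rewrite distrC /s /s' -mulrBl -cA' natrD addrAC subrr add0r ger0_norm //.
        by rewrite divr_ge0 // ltW.
      by apply: plim_lipschitz => //; rewrite ?s0 ?s'0.
    apply: le_trans h1; rewrite -real_normK ?num_real // expr2.
    by rewrite ler_piMl // ler_norml; move: c01 c'01 => /andP[? ?] /andP[? ?]; lra.
  apply: (@le_trans _ _ (E (fun w =>
      ((tg k.+1 i A' w <= q)%N%:R - c) * ((tg k.+1 j A' w <= q)%N%:R - c) +
      (tg k.+1 i (A :\ i) w != tg k.+1 i (A :\ i :\ j) w)%:R +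
      (tg k.+1 j (A :\ j) w != tg k.+1 j (A :\ j :\ i) w)%:R))).
    apply: ler_Ex => // w; rewrite /Y -A'E -/A'.
    apply: le_trans (norm_ind_sub_prod (tg k.+1 i (A :\ i) w <= q)%N
      (tg k.+1 i A' w <= q)%N (tg k.+1 j (A :\ j) w <= q)%N (tg k.+1 j A' w <= q)%N c01) _.
    have ind (a b : nat) : ((a <= q)%N != (b <= q)%N)%:R <= (a != b)%:R :> R.
      by case: (eqVneq a b) => [->|_]; rewrite ?eqxx // ler_nat leq_b1.
    by rewrite -!addrA lerD2l lerD.
  rewrite !ExD Ex_pair //.
  have l1 : E (fun w => (tg k.+1 i (A :\ i) w != tg k.+1 i (A :\ i :\ j) w)%:R) <= K / N.
    apply: Ex_remove; rewrite ?finset.setD11 //.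
    by apply: le_trans A2N; rewrite ler_nat subset_leq_card // subD1set.
  have l2 : E (fun w => (tg k.+1 j (A :\ j) w != tg k.+1 j (A :\ j :\ i) w)%:R) <= K / N.
    apply: Ex_remove; rewrite ?finset.setD11 //.
    by apply: le_trans A2N; rewrite ler_nat subset_leq_card // subD1set.
  have l3 : E (fun w => (expR (- load k A' q w) - c) ^+ 2) <= 2 * (B / N) + 2 * (K * (2 / N)).
    apply: (@le_trans _ _ (E (fun w => 2 * (expR (- load k A' q w) - c') ^+ 2 +
        2 * (K * (2 / N))))).
      apply: ler_Ex => // w; set h := expR _; apply: (@le_trans _ _ (2 * (h - c') ^+ 2 + 2 * (c' - c) ^+ 2)).
        by rewrite -subr_ge0 (_ : _ - _ = (h - c' - (c' - c)) ^+ 2) ?sqr_ge0 //; ring.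
      by rewrite lerD2l ler_wpM2l.
    rewrite ExD ExZ Ex_cst // lerD2r ler_wpM2l //.
    by apply: Ex_sqr_expR_load => r rM; exact: IHk.
  apply: le_trans (lerD (lerD l3 l1) l2) _.
  by rewrite le_eqVlt; apply/orP; left; apply/eqP; field; rewrite gt_eqF.
have diag i : E (fun w => Y i w * Y i w) <= 1.
  rewrite -[leRHS](Ex_cst p_sum1 1); apply: ler_Ex => // w.
  rewrite -expr2 -real_normK ?num_real // expr_le1 //.
  exact: norm_ind_sub_le1.
under Ex_ext do rewrite devE exprMn expr2 mulr_suml GRing.mulrC.
rewrite ExZ Ex_sum.
have row i : i \in A -> E (fun w => Y i w * \sum_(j in A) Y j w) <= 1 + 2 * (6 * K + 2 * B).
  move=> iA; under Ex_ext do rewrite (bigD1 i) //= mulrDr mulr_sumr.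
  rewrite ExD Ex_sum; apply: lerD => //.
  apply: le_trans (sum_le_card (c := (6 * K + 2 * B) / N) _) _.
    by move=> j /andP[jA ji]; apply: off => //; rewrite eq_sym.
  apply: (@le_trans _ _ (2 * N * ((6 * K + 2 * B) / N))).
    apply: ler_wpM2r; first by rewrite divr_ge0 ?(ltW N_gt0) // addr_ge0 // mulr_ge0.
    by apply: le_trans A2N; rewrite ler_nat subset_leq_card //; apply/fintype.subsetP => j /andP[].
  by rewrite le_eqVlt; apply/orP; left; apply/eqP; field; rewrite gt_eqF.
have tot : \sum_(i in A) E (fun w => Y i w * \sum_(j in A) Y j w) <=
    2 * N * (1 + 2 * (6 * K + 2 * B)).
  apply: le_trans (sum_le_card row) _; apply: ler_wpM2r => //.
  by rewrite addr_ge0 // mulr_ge0 // addr_ge0 // mulr_ge0.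
apply: le_trans (ler_wpM2l _ tot) _; first by rewrite exprn_ge0 // invr_ge0 ltW.
have -> : conc_cst M phi k.+1 = 2 + 24 * K + 8 * B by [].
by rewrite le_eqVlt; apply/orP; left; apply/eqP; field; rewrite gt_eqF.
Qed.

(** Each gain has its own graph [below j]. For [i < j] the gain of [i] is fixed by the edges inside
    [below j], so only the star of [j] has to be averaged and no vertex is deleted. *)
Lemma Ex_prefix_sqr k q (e : R) : 0 < e -> n%:R <= 2 * N -> (q < M)%N ->
  E (fun w => (\sum_(j < n) ((tg k.+1 j (below n j) w <= q)%N%:R -
                plim M phi (j%:R / N) k.+1 q)) ^+ 2) <=
  n%:R + n%:R ^+ 2 * (e + dev_bound M phi (conc_cst M phi k) / (N * e)).
Proof.
move=> e0 n2N qM; set B := dev_bound _ _ _.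
pose c (j : nat) := plim M phi (j%:R / N) k.+1 q.
pose Y (j : 'I_n) w : R := (tg k.+1 j (below n j) w <= q)%N%:R - c j.
have B0 : 0 <= B by apply: dev_bound_ge0 => //; exact: conc_cst_ge0.
have c01 (j : nat) : 0 <= c j <= 1.
  by rewrite ltW ?plim_gt0 // plim_le1 // divr_ge0 // ltW.
have Y1 j w : `|Y j w| <= 1 by exact: norm_ind_sub_le1.
have pos : 0 <= e + B / (N * e) 
  by apply: addr_ge0; [exact: ltW|apply: divr_ge0 => //; apply: mulr_ge0; exact: ltW].
have off (i j : 'I_n) : (i < j)%N -> E (fun w => Y i w * Y j w) <= e + B / (N * e).
  move=> ij; rewrite Ex_cond_sub ?below_notin //; last first.
    move=> w f l fA; rewrite /Y (@trunc_gain_indep k.+1 j i (below n i) (below n j)) ?below_notin //.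
    by rewrite !inE negb_or -val_eqE neq_ltn ij orbT /= -leqNgt ltnW.
  set h := fun w => expR (- load k (below n j) q w) - c j.
  have hb : E (fun w => h w ^+ 2) <= B / N.
    rewrite /h /c -{2}(card_below j); apply: Ex_sqr_expR_load => r rM; apply: Ex_dev => //.
    by apply: le_trans n2N; rewrite card_below ler_nat ltnW.
  (* Only the second moment of [h] is under control; [|h| <= e + h ^ 2 / e] turns it into a bound on
     the first moment, with [e] left free. *)
  apply: (@le_trans _ _ (E (fun w => e + e^-1 * h w ^+ 2))).
    apply: ler_Ex => // w; apply: (@le_trans _ _ `|h w|).
      by apply: le_trans (ler_norm _) _; rewrite normrM ler_piMl.
    have [he|he] := leP `|h w| e.
      by rewrite -[leLHS]addr0 lerD // mulr_ge0 ?sqr_ge0 // invr_ge0 ltW.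
    apply: (@le_trans _ _ (e^-1 * h w ^+ 2)); last by rewrite lerDr ltW.
    by rewrite ler_pdivlMl // -[h w ^+ 2]real_normK ?num_real // expr2 ler_wpM2r // ltW.
  rewrite ExD Ex_cst // ExZ lerD2l; apply: le_trans (ler_wpM2l _ hb) _; first by rewrite invr_ge0 ltW.
  by rewrite invfM mulrCA [e^-1 * _]GRing.mulrC.
have pair (i j : 'I_n) : E (fun w => Y i w * Y j w) <= (i == j)%:R + (e + B / (N * e)).
  case: (ltngtP i j) => [ij|ji|/val_inj <-].
  - by rewrite -val_eqE (ltn_eqF ij) add0r; exact: off.
  - by rewrite -val_eqE (gtn_eqF ji) add0r; under Ex_ext do rewrite GRing.mulrC; exact: off.
  - apply: (@le_trans _ _ 1); last by rewrite eqxx lerDl.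
    rewrite -[leRHS](Ex_cst p_sum1 1); apply: ler_Ex => // w.
    by rewrite -expr2 -real_normK ?num_real // expr_le1.
have -> : E (fun w => (\sum_(j < n) Y j w) ^+ 2) =
    \sum_(i < n) \sum_(j < n) E (fun w => Y i w * Y j w).
  transitivity (E (fun w => \sum_(i < n) \sum_(j < n) Y i w * Y j w)).
    by apply: Ex_ext => w; rewrite expr2 mulr_suml; apply: eq_bigr => i _; rewrite mulr_sumr.
  by rewrite Ex_sum; apply: eq_bigr => i _; rewrite Ex_sum.
apply: (@le_trans _ _ (\sum_(i < n) (1 + n%:R * (e + B / (N * e))))).
  apply: ler_sum => i _.
  apply: (@le_trans _ _ (\sum_(j < n) ((i == j)%:R + (e + B / (N * e))))).
    by apply: ler_sum => j _; exact: pair.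
  rewrite big_split /= sumr_const card_ord mulr_natl lerD2r.
  rewrite (bigD1 i) //= eqxx big1 ?addr0 // => j ji.
  by rewrite eq_sym (negbTE ji).
by rewrite sumr_const card_ord -[leLHS]mulr_natl mulrDr mulr1 expr2 -mulrA.
Qed.

Lemma Ex_total_sqr k (e : R) : 0 < e -> n%:R <= 2 * N ->
  E (fun w => (\sum_(j < n) ((tg k.+1 j (below n j) w)%:R -
                xlim M phi (j%:R / N) k.+1)) ^+ 2) <=
  M%:R ^+ 2 * (n%:R + n%:R ^+ 2 * (e + dev_bound M phi (conc_cst M phi k) / (N * e))).
Proof.
move=> e0 n2N.
pose Z q w := \sum_(j < n) ((tg k.+1 j (below n j) w <= q)%N%:R - plim M phi (j%:R / N) k.+1 q).
apply: (@le_trans _ _ (E (fun w => M%:R * \sum_(q < M) Z q w ^+ 2))).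
  apply: ler_Ex => // w.
  have -> : \sum_(j < n) ((tg k.+1 j (below n j) w)%:R - xlim M phi (j%:R / N) k.+1) =
      - \sum_(q < M) Z q w.
    rewrite /Z exchange_big -sumrN; apply: eq_bigr => j _.
    have tgM : (tg k.+1 j (below n j) w <= M)%N.
      by apply: trunc_gain_le => f; rewrite /levels -ltnS ltn_ord.
    by rewrite (nat_layers R tgM) /xlim -sumrB -sumrN; apply: eq_bigr => q _; ring.
  by rewrite sqrrN sqr_sum_le.
rewrite ExZ Ex_sum [M%:R ^+ 2]expr2 -mulrA ler_wpM2l //.
rewrite -[X in X%:R * _](card_ord M); apply: (@sum_le_card _ _ xpredT) => q _.
exact: Ex_prefix_sqr.
Qed.

End Model.

Lemma total_concentration (R : realType) (M : nat) (phi : nat -> R) (k : nat) (eps : R) :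
  phi 0%N = 0 -> {homo phi : a b / (a <= b)%N >-> a <= b} -> 0 < eps ->
  exists n0, forall (n : nat) (N : R) (p : 'I_n * 'I_n -> 'I_M.+1 -> R),
    (n0 <= n)%N -> n%:R <= 2 * N ->
    (forall e j, 0 <= p e j) -> (forall e, \sum_j p e j = 1) ->
    (forall e b, is_edge e -> lower_mass p e b = expR (- (phi (M - b)%N / N))) ->
    Ex p (fun w => (eps * n%:R <= `|\sum_(j < n) (trunc_gain (levels w) k.+1 j (below n j))%:R -
        \sum_(j < n) xlim M phi (j%:R / N) k.+1|)%R%:R) <= eps.
Proof.
move=> phi0 phih eps0.
set B := dev_bound M phi (conc_cst M phi k).
have B0 : 0 <= B by apply: dev_bound_ge0 => //; exact: conc_cst_ge0.
(* Markov's inequality for the square at level [(eps * n) ^ 2] asks for a mean of at most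
   [eps ^ 3 * n ^ 2]; the second moment will be at most [2 * M ^ 2 * e * n ^ 2]. *)
pose e := eps ^+ 3 / (2 * (M%:R ^+ 2 + 1)).
have M0 : 0 < M%:R ^+ 2 + 1 :> R by rewrite ltr_wpDl // exprn_ge0.
have e0 : 0 < e by rewrite divr_gt0 ?exprn_gt0 // mulr_gt0.
(* The quotient makes the remaining terms of the second moment at most [n ^ 2 * e]; the [.+2] gives
   [2 <= n], hence [1 <= N]. *)
exists (Num.truncn ((1 + 2 * B / e) / e)).+2 => n N p n0n n2N p0 p1 pc.
have nc : (1 + 2 * B / e) / e <= n%:R.
  apply/ltW/(lt_le_trans (truncnS_gt _)); rewrite ler_nat; exact: ltnW.
have n2 : 2 <= n%:R :> R by rewrite ler_nat; apply: leq_trans n0n.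
have N1 : 1 <= N by lra.
have N0 : 0 < N by lra.
have n_gt0 : 0 < n%:R :> R by lra.
under Ex_ext do rewrite -sumrB.
apply: (@le_trans _ _ (Ex p (fun w => ((eps * n%:R) ^+ 2 <= (\sum_(j < n)
   ((trunc_gain (levels w) k.+1 j (below n j))%:R - xlim M phi (j%:R / N) k.+1)) ^+ 2)%R%:R))).
  apply: ler_Ex => // w; set z := \sum_(j < n) _.
  rewrite -[z ^+ 2]real_normK ?num_real // ler_pXn2r ?nnegrE ?normr_ge0 //.
  by rewrite mulr_ge0 // ltW.
apply: le_trans (Ex_markov p0 _ _) _ => [|w|]; rewrite ?sqr_ge0 ?exprn_gt0 ?mulr_gt0 //.
rewrite ler_pdivrMr ?exprn_gt0 ?mulr_gt0 //.
apply: le_trans (Ex_total_sqr phi0 phih N1 p0 p1 pc k e0 n2N) _.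
rewrite -/B.
have h1 : n%:R + n%:R ^+ 2 * (B / (N * e)) <= n%:R ^+ 2 * e.
  apply: (@le_trans _ _ (n%:R * (1 + 2 * B / e))); last first.
    by rewrite expr2 -[leRHS]mulrA; apply: ler_wpM2l; rewrite ?(ltW n_gt0) // -ler_pdivrMr.
  rewrite mulrDr mulr1 lerD2l expr2 -[leLHS]mulrA.
  apply: ler_wpM2l; rewrite ?(ltW n_gt0) //.
  have -> : n%:R * (B / (N * e)) = n%:R / N * (B / e) by field; rewrite !gt_eqF.
  rewrite -[leRHS]mulrA; apply: ler_wpM2r; first by rewrite divr_ge0 // ltW.
  by rewrite ler_pdivrMr.
apply: (@le_trans _ _ (M%:R ^+ 2 * (2 * (n%:R ^+ 2 * e)))).
  by rewrite ler_wpM2l ?exprn_ge0 // mulrDr; lra.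
have -> : eps * (eps * n%:R) ^+ 2 = n%:R ^+ 2 * (e * (2 * (M%:R ^+ 2 + 1))).
  by rewrite /e divfK ?gt_eqF ?mulr_gt0 // exprMn exprS mulrA mulrC.
have := mulr_ge0 (sqr_ge0 (n%:R : R)) (ltW e0); nra.
Qed.

(** * Replica symmetry *)

Section FixedPoint.
Variables (R : realType) (M : nat) (phi : nat -> R).
Hypothesis phi0 : phi 0%N = 0.
Hypothesis phi_homo : {homo phi : a b / (a <= b)%N >-> a <= b}.
Hypothesis kap_homo : {homo kap phi : a b / (a <= b)%N >-> a <= b}.

Definition avg (s : R) (u : nat -> R) (q : nat) : R :=
  s * \sum_(r < M) kap phi (M - q - r) * u r.

Definition expavg (s : R) (u : nat -> R) (q : nat) : R := expR (- avg s u q).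

Lemma kap0 : kap phi 0 = 0. Proof. exact: subrr. Qed.

Lemma avgM s u : avg s u M = 0.
Proof. by rewrite /avg subnn big1 ?mulr0 // => r _; rewrite sub0n kap0 mul0r. Qed.

Lemma avg_step s u q :
  avg s u q - avg s u q.+1 =
  s * \sum_(r < M) (kap phi (M - q - r) - kap phi (M - q - r.+1)) * u r.
Proof.
rewrite /avg -mulrBr -sumrB; congr (_ * _); apply: eq_bigr => r _.
by rewrite -mulrBl -!subnDA addSn addnS.
Qed.

Lemma avg_step_ge0 s u q : 0 <= s -> (forall r, 0 <= u r) -> 0 <= avg s u q - avg s u q.+1.
Proof.
move=> s0 u0; rewrite avg_step mulr_ge0 // sumr_ge0 // => r _.
by rewrite mulr_ge0 // subr_ge0 kap_homo // leq_sub2l.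
Qed.

Lemma avg_step_le s u q : 0 <= s -> (forall r, 0 <= u r <= 1) ->
  avg s u q - avg s u q.+1 <= s * kap phi M.
Proof.
move=> s0 u01; rewrite avg_step ler_wpM2l //.
apply: (@le_trans _ _ (\sum_(r < M) (kap phi (M - q - r) - kap phi (M - q - r.+1)))).
  apply: ler_sum => r _; have /andP[u0 u1] := u01 r; rewrite ler_piMr // subr_ge0 kap_homo //.
  by rewrite leq_sub2l.
rewrite -(big_mkord xpredT (fun r => kap phi (M - q - r) - kap phi (M - q - r.+1))).
under eq_bigr do rewrite -opprB.
rewrite sumrN telescope_sumr // subn0 opprB.
rewrite (_ : (M - q - M)%N = 0%N); last by lia.
by rewrite kap0 subr0 kap_homo // leq_subr.
Qed.

(* The kernel kap (M - q - r) depends on q + r only; summing by parts therefore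
   makes the two sides of the coupled fixed-point equations equal up to s1 / s2. *)
Lemma avg_symmetry s1 s2 (u v : nat -> R) :
  s1 * \sum_(q < M) v q * (avg s2 u q - avg s2 u q.+1) =
  s2 * \sum_(q < M) u q * (avg s1 v q - avg s1 v q.+1).
Proof.
under eq_bigr do rewrite avg_step mulrCA mulr_sumr; rewrite -mulr_sumr.
under [in RHS]eq_bigr do rewrite avg_step mulrCA mulr_sumr; rewrite -mulr_sumr.
rewrite mulrCA [in RHS]exchange_big /=; congr (_ * (_ * _)).
apply: eq_bigr => q _; apply: eq_bigr => r _.
have -> : (M - r - q = M - q - r)%N by lia.
have -> : (M - r - q.+1 = M - q - r.+1)%N by lia.
ring.
Qed.

(** A Riemann sum for the integral of [expR (- a)] in the variable [a = avg s u]. As [avg] vanishes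
    at [M], the exact increments telescope to [1 - expavg s u 0]; no step of [avg] exceeds
    [s * kap phi M], which is the relative error. *)
Lemma sum_expavg_ge s u : 0 <= s -> (forall r, 0 <= u r <= 1) ->
  (1 - expavg s u 0) * (1 - s * kap phi M) <=
  \sum_(q < M) expavg s u q * (avg s u q - avg s u q.+1).
Proof.
move=> s0 u01; have u0 r : 0 <= u r by case/andP: (u01 r).
have -> : 1 - expavg s u 0 = \sum_(q < M) (expavg s u q.+1 - expavg s u q).
  rewrite -(big_mkord xpredT (fun q => expavg s u q.+1 - expavg s u q)) telescope_sumr //.
  by rewrite {2}/expavg avgM oppr0 expR0.
rewrite mulr_suml; apply: ler_sum => q _.
set D := s * _; have d0 := avg_step_ge0 q s0 u0; have dD := avg_step_le q s0 u01.
rewrite -/D in dD; move: d0 dD; set d := avg s u q - avg s u q.+1 => d0 dD.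
have E : expavg s u q = expavg s u q.+1 * expR (- d).
  by rewrite /expavg -expRD; congr expR; rewrite /d; ring.
have x0 := expR_gt0 (- avg s u q.+1); rewrite -/(expavg s u q.+1) in x0.
rewrite E; move: x0; set x := expavg s u q.+1 => x0.
have e1 : 1 - d <= expR (- d) by have := expR_ge1Dx (- d).
have e2 : expR (- d) <= 1 by rewrite -expR0 ler_expR; lra.
have h1 : x * (1 - expR (- d)) * (1 - D) <= x * (1 - expR (- d)) * (1 - d).
  by apply: ler_wpM2l; [apply: mulr_ge0; [exact: ltW|lra]|lra].
have h2 : x * (1 - expR (- d)) <= x * d by apply: ler_wpM2l; [exact: ltW|lra].
nra.
Qed.

Lemma sum_expavg_le s u : 0 <= s ->
  \sum_(q < M) expavg s u q * (avg s u q - avg s u q.+1) <= 1 - expavg s u 0.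
Proof.
move=> s0.
have -> : 1 - expavg s u 0 = \sum_(q < M) (expavg s u q.+1 - expavg s u q).
  rewrite -(big_mkord xpredT (fun q => expavg s u q.+1 - expavg s u q)) telescope_sumr //.
  by rewrite {2}/expavg avgM oppr0 expR0.
apply: ler_sum => q _; set d := _ - _.
have -> : expavg s u q.+1 = expavg s u q * expR d.
  by rewrite /expavg -expRD; congr expR; rewrite /d; ring.
have := expR_ge1Dx d; have := expR_gt0 (- avg s u q); rewrite -/(expavg s u q); nra.
Qed.

(** By [avg_symmetry] the same double sum is bounded below through [1 - v 0] and above through
    [1 - u 0], giving [s1 * (1 - v 0) * (1 - s2 * kap phi M) <= s2 * (1 - u 0)]. This ties the two
    solutions together at 0 only. *)
Lemma fixed_point_gap0 s1 s2 (u v : nat -> R) : 0 <= s1 <= s2 ->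
  (forall q, u q = expavg s1 v q) -> (forall q, v q = expavg s2 u q) ->
  (forall q, 0 <= v q) -> (forall q, v q <= u q) -> (forall q, u q <= 1) ->
  s2 * (u 0%N - v 0%N) <= (s2 - s1) + s2 ^+ 2 * kap phi M.
Proof.
move=> /andP[s10 s12] uE vE v0 vu u1.
have s20 := le_trans s10 s12.
have u01 q : 0 <= u q <= 1 by rewrite u1 (le_trans (v0 q) (vu q)).
have h1 := sum_expavg_ge s20 u01; have h2 := @sum_expavg_le s1 v s10.
have h3 := avg_symmetry s1 s2 u v.
have uE' : u = expavg s1 v by apply/funext.
have vE' : v = expavg s2 u by apply/funext.
rewrite -vE' in h1; rewrite -uE' in h2.
have {}h1 := ler_wpM2l s10 h1; have {}h2 := ler_wpM2l s20 h2.
rewrite -h3 in h2; have h5 := le_trans h1 h2.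
have k0 := @kap_ge0 _ _ phi_homo M.
have v01 : 0 <= 1 - v 0%N <= 1 by rewrite subr_ge0 (le_trans (vu _)) //= lerBlDr lerDl.
have : 0 <= s2 * kap phi M by rewrite mulr_ge0.
move: v01 h5; set K := kap phi M; set x := v 0%N; set y := u 0%N => /andP[x0 x1] h5 k1.
have : s1 * (s2 * K) <= s2 * (s2 * K) by rewrite ler_wpM2r.
have : (1 - x) * (s2 - s1 + s1 * (s2 * K)) <= s2 - s1 + s1 * (s2 * K).
  by rewrite ler_piMl // addr_ge0 ?mulr_ge0 // subr_ge0.
nra.
Qed.

(** The gap at 0 controls the gap everywhere: [u 0 / v 0] is the exponential of
    [avg s2 u 0 - avg s1 v 0], which dominates [s1] times the weighted sum of the nonnegative
    differences [u r - v r]. The factor [expR (3 * phi M)] inverts the lower bound on [v 0], and 9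
    bounds [s2 ^ 2]. *)
Lemma fixed_point_gap s1 s2 (u v : nat -> R) : 0 <= s1 <= s2 -> s2 <= 3 ->
  (forall q, u q = expavg s1 v q) -> (forall q, v q = expavg s2 u q) ->
  (forall q, 0 <= v q) -> (forall q, v q <= u q) -> (forall q, u q <= 1) ->
  s1 * s2 * \sum_(r < M) kap phi (M - r) * (u r - v r) <=
  ((s2 - s1) + 9 * kap phi M) * expR (3 * phi M).
Proof.
move=> /andP[s10 s12] s23 uE vE v0 vu u1.
have s20 := le_trans s10 s12.
have u0 q : 0 <= u q := le_trans (v0 q) (vu q).
have k0 := @kap_ge0 _ _ phi_homo.
have p0 := phi_ge0 phi0 phi_homo.
have g0 : s2 * (u 0%N - v 0%N) <= (s2 - s1) + 9 * kap phi M.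
  apply: le_trans (fixed_point_gap0 _ uE vE v0 vu u1) _; first by rewrite s10.
  by rewrite lerD2l ler_wpM2r //; nra.
have h1 : s1 * \sum_(r < M) kap phi (M - r) * (u r - v r) <= avg s2 u 0 - avg s1 v 0.
  rewrite /avg subn0; under eq_bigr do rewrite mulrBr.
  rewrite sumrB mulrBr lerD2r ler_wpM2r // sumr_ge0 // => r _.
  by rewrite mulr_ge0 ?k0 ?u0.
have h2 : v 0%N * (avg s2 u 0 - avg s1 v 0) <= u 0%N - v 0%N.
  have -> : u 0%N = v 0%N * expR (avg s2 u 0 - avg s1 v 0).
    by rewrite [in RHS]vE uE /expavg -expRD; congr expR; ring.
  have := expR_ge1Dx (avg s2 u 0 - avg s1 v 0); have := v0 0%N; nra.
have h3 : 1 <= v 0%N * expR (3 * phi M).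
  rewrite vE /expavg -expRD -[leLHS]expR0 ler_expR addrC subr_ge0.
  rewrite /avg subn0; apply: ler_pM => //.
    by rewrite sumr_ge0 // => r _; rewrite mulr_ge0 ?k0 ?u0.
  by have := @sum_kap_le _ M _ phi0 phi_homo 0 u 1 ler01 u1; rewrite subn0 mulr1.
set S := \sum_(r < M) _ in h1 *.
have S0 : 0 <= S.
  by rewrite sumr_ge0 // => r _; rewrite mulr_ge0 ?k0 // subr_ge0.
have E0 := expR_gt0 (3 * phi M).
set X := expR _ in h3 E0 *.
have h4 : v 0%N * (s1 * S) <= u 0%N - v 0%N by apply: le_trans h2; rewrite ler_wpM2l.
have h5 : s2 * (v 0%N * (s1 * S)) <= (s2 - s1) + 9 * kap phi M.
  by apply: le_trans g0; rewrite ler_wpM2l.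
have := ler_wpM2r (ltW E0) h5; apply: le_trans.
have -> : s2 * (v 0%N * (s1 * S)) * X = s1 * s2 * S * (v 0%N * X) by ring.
by rewrite ler_peMr // !mulr_ge0.
Qed.

(* The recursion for [plim] with the parameter alternating between [s1] and [s2]: it
   bounds [plim s] for all [s] in [s1, s2] simultaneously. *)
Fixpoint wlim (s1 s2 : R) (k : nat) : nat -> R :=
  if k is k'.+1 then expavg (if odd k' then s1 else s2) (wlim s1 s2 k') else fun=> 1.

Lemma expavg_anti s s' (u u' : nat -> R) q : 0 <= s -> s <= s' ->
  (forall r, 0 <= u r) -> (forall r, u r <= u' r) -> expavg s' u' q <= expavg s u q.
Proof.
move=> s0 ss' u0 uu'; rewrite ler_expR lerN2; apply: ler_pM => //.
  by rewrite sumr_ge0 // => r _; rewrite mulr_ge0 ?kap_ge0.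
by apply: ler_sum => r _; rewrite ler_wpM2l ?kap_ge0.
Qed.

Lemma expavg_le1 s u q : 0 <= s -> (forall r, 0 <= u r) -> expavg s u q <= 1.
Proof.
move=> s0 u0; rewrite -expR0 ler_expR oppr_le0 mulr_ge0 // sumr_ge0 // => r _.
by rewrite mulr_ge0 ?kap_ge0.
Qed.

Lemma wlim_ge0 s1 s2 k q : 0 <= wlim s1 s2 k q.
Proof. by case: k => [|k] /=; rewrite ?ler01 ?expR_ge0. Qed.

Section Window.
Variables s1 s2 : R.
Hypotheses (s1_ge0 : 0 <= s1) (s12 : s1 <= s2).

Let s2_ge0 : 0 <= s2. Proof. exact: le_trans s12. Qed.

Lemma wlim_le1 k q : wlim s1 s2 k q <= 1.
Proof.
case: k => [|k] //=; apply: expavg_le1; first by case: ifP.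
by move=> r; exact: wlim_ge0.
Qed.

Lemma plim_window s k : s1 <= s <= s2 ->
  if odd k then forall q, wlim s1 s2 k q <= plim M phi s k q
  else forall q, plim M phi s k q <= wlim s1 s2 k q.
Proof.
move=> /andP[s1s ss2]; have s0 := le_trans s1_ge0 s1s.
elim: k => [|k] //=; case: (odd k) => /= IHk q.
  by apply: expavg_anti => // r; exact: wlim_ge0.
by apply: (@expavg_anti s s2) => // r; rewrite ltW // plim_gt0.
Qed.

Lemma wlim_step2 k :
  if odd k then forall q, wlim s1 s2 k q <= wlim s1 s2 k.+2 q
  else forall q, wlim s1 s2 k.+2 q <= wlim s1 s2 k q.
Proof.
elim: k => [|k]; first by move=> q; exact: wlim_le1.
case Ek: (odd k) => IHk; rewrite oddS Ek /= => q.
  rewrite Ek /=; apply: expavg_anti => // r; first exact: wlim_ge0.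
  by have := IHk r; rewrite /= Ek.
rewrite Ek /=; apply: expavg_anti => // r; first exact: expR_ge0.
by have := IHk r; rewrite /= Ek.
Qed.

Lemma wlim_step k :
  if odd k then forall q, wlim s1 s2 k q <= wlim s1 s2 k.+1 q
  else forall q, wlim s1 s2 k.+1 q <= wlim s1 s2 k q.
Proof.
elim: k => [|k]; first by move=> q; exact: wlim_le1.
case Ek: (odd k) => IHk; rewrite oddS Ek /= => q.
  rewrite Ek /=; apply: expavg_anti => // r; first exact: wlim_ge0.
  by have := IHk r; rewrite /= Ek.
rewrite Ek /=; apply: expavg_anti => // r; first exact: expR_ge0.
by have := IHk r; rewrite /= Ek.
Qed.

Lemma cvg_expavg s (u : nat -> nat -> R) (l : nat -> R) q :
  (forall r, u ^~ r @ \oo --> l r) -> expavg s (u n) q @[n --> \oo] --> expavg s l q.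
Proof.
move=> ul; rewrite /expavg; apply: continuous_cvg; first exact: continuous_expR.
apply: cvgN; apply: cvgMr; apply: (@cvg_big _ _ +%R); first exact: add_continuous.
by move=> r _; apply: cvgMr; exact: ul.
Qed.

(** Even iterates decrease and odd iterates increase, so both converge, and by continuity the limits
    solve the coupled equations. The limits need not agree; [fixed_point_gap] bounds their
    distance. *)
Lemma wlim_limits : exists u v : nat -> R,
  [/\ forall q, wlim s1 s2 k.*2 q @[k --> \oo] --> u q,
      forall q, wlim s1 s2 k.*2.+1 q @[k --> \oo] --> v q,
      (forall q, u q = expavg s1 v q) /\ (forall q, v q = expavg s2 u q) &
      [/\ forall q, 0 <= v q, forall q, v q <= u q & forall q, u q <= 1]].
Proof.
have cu q : cvgn (fun k => wlim s1 s2 k.*2 q).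
  apply: nonincreasing_is_cvgn.
    by apply/nonincreasing_seqP => k; have := wlim_step2 k.*2; rewrite odd_double => /(_ q).
  by exists 0 => _ [k _ <-]; exact: wlim_ge0.
have cv q : cvgn (fun k => wlim s1 s2 k.*2.+1 q).
  apply: nondecreasing_is_cvgn.
    by apply/nondecreasing_seqP => k; have := wlim_step2 k.*2.+1; rewrite oddS odd_double => /(_ q).
  by exists 1 => _ [k _ <-]; exact: wlim_le1.
pose u q := lim (wlim s1 s2 k.*2 q @[k --> \oo]).
pose v q := lim (wlim s1 s2 k.*2.+1 q @[k --> \oo]).
have ul q : wlim s1 s2 k.*2 q @[k --> \oo] --> u q by exact: cu.
have vl q : wlim s1 s2 k.*2.+1 q @[k --> \oo] --> v q by exact: cv.
exists u, v; split=> //.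
  split=> q.
    have h : wlim s1 s2 k.+1.*2 q @[k --> \oo] --> u q.
      by rewrite (cvg_shiftS (fun k => wlim s1 s2 k.*2 q)); exact: ul.
    have E k : wlim s1 s2 k.+1.*2 q = expavg s1 (wlim s1 s2 k.*2.+1) q.
      by rewrite doubleS /= odd_double.
    have h2 := @cvg_expavg s1 (fun k => wlim s1 s2 k.*2.+1) v q vl.
    rewrite -(eq_cvg _ _ E) in h2; exact: norm_cvg_unique h h2.
  have E k : wlim s1 s2 k.*2.+1 q = expavg s2 (wlim s1 s2 k.*2) q by rewrite /= odd_double.
  have h2 := @cvg_expavg s2 (fun k => wlim s1 s2 k.*2) u q ul.
  rewrite -(eq_cvg _ _ E) in h2; exact: norm_cvg_unique (vl q) h2.
split=> q.
- by apply: limr_ge => //; near=> k; exact: wlim_ge0.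
- apply: ler_lim => //; near=> k; have := wlim_step k.*2; rewrite odd_double; exact.
- by apply: limr_le => //; near=> k; exact: wlim_le1.
Unshelve. all: by end_near. Qed.

(** [fixed_point_gap] weighs the differences by [kap phi (M - r)], which degenerates for [r] near
    [M]. The last [M %/ J] indices are therefore bounded by 1 each; for the others, monotonicity of
    [kap] gives [kap phi m >= phi m / M >= b / M]. *)
Lemma window_gap (J : nat) (b : R) : (0 < J)%N -> 0 < s1 -> s2 <= 3 -> 0 < b ->
  (forall m, (M < m * J)%N -> b <= phi m) ->
  forall c, M%:R * (J%:R^-1 + ((s2 - s1) + 9 * kap phi M) * expR (3 * phi M) / (s1 * s2 * b)) < c ->
  \forall k \near \oo, \sum_(r < M) (wlim s1 s2 k.*2.+2 r - wlim s1 s2 k.*2.+1 r) <= c.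
Proof.
move=> J0 s10 s23 b0 bphi c hc; have [u [v [ul vl [uE vE] [v0 vu u1]]]] := wlim_limits.
have s20 : 0 < s2 by exact: lt_le_trans s12.
have gap : s1 * s2 * \sum_(r < M) kap phi (M - r) * (u r - v r) <=
    ((s2 - s1) + 9 * kap phi M) * expR (3 * phi M).
  by apply: fixed_point_gap => //; rewrite s1_ge0.
have kapb m : (m <= M)%N -> (M < m * J)%N -> b / M%:R <= kap phi m.
  move=> mM mJ; have M0 : 0 < M%:R :> R.
    by rewrite ltr0n (leq_trans _ mM) // lt0n; apply: contraTneq mJ => ->; rewrite mul0n.
  rewrite ler_pdivrMr //; apply: le_trans (bphi m mJ) _.
  have := @sum_kap R m phi phi0 0; rewrite subn0 => <-.
  apply: le_trans (sum_le_card (c := kap phi m) _) _.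
    by move=> r _; rewrite kap_homo // leq_subr.
  by rewrite card_ord mulrC ler_wpM2l ?kap_ge0 // ler_nat.
have uv : \sum_(r < M) (u r - v r) < c.
  apply: le_lt_trans hc.
  apply: (@le_trans _ _ (\sum_(r < M) ((1 - (M %/ J <= M - r.+1)%N%:R) +
      M%:R / b * (kap phi (M - r) * (u r - v r))))).
    apply: ler_sum => r _.
    have uv0 : 0 <= u r - v r by rewrite subr_ge0.
    have uv1 : u r - v r <= 1 by have := u1 r; have := v0 r; lra.
    have M0 : 0 < M%:R :> R by rewrite ltr0n; apply: leq_ltn_trans (ltn_ord r).
    case: leqP => /= h; last first.
      rewrite subr0 -[leLHS]addr0; apply: lerD => //.
      by rewrite mulr_ge0 ?divr_ge0 ?mulr_ge0 ?kap_ge0 ?(ltW b0).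
    rewrite subrr add0r mulrA ler_peMl //.
    have kb : b / M%:R <= kap phi (M - r).
      apply: kapb; first exact: leq_subr.
      by have rM := ltn_ord r; clear -J0 h rM; rewrite -ltn_divLR //; lia.
    by rewrite mulrAC ler_pdivlMr // mul1r mulrC -ler_pdivrMr.
  rewrite big_split /= mulrDr; apply: lerD.
    rewrite (reindex_inj rev_ord_inj) /=.
    rewrite (eq_bigr (fun r : 'I_M => 1 - (M %/ J <= r)%N%:R)); last first.
      move=> r _; rewrite (_ : (M - (M - r.+1).+1)%N = r) //; have := ltn_ord r; lia.
    rewrite -nat_layers ?leq_div // ler_pdivlMr ?ltr0n // -natrM ler_nat.
    exact: leq_divM.
  rewrite -mulr_sumr; move: gap; set Z := \sum_(r < M) _; set X := _ * expR _ => gap.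
  have ZX : Z <= X / (s1 * s2) by rewrite ler_pdivlMr ?mulr_gt0 // mulrC.
  apply: (@le_trans _ _ (M%:R / b * (X / (s1 * s2)))).
    by apply: ler_wpM2l => //; rewrite divr_ge0 // ltW.
  by rewrite le_eqVlt; apply/orP; left; apply/eqP; field; rewrite !gt_eqF.
have h1 : \sum_(r < M) (wlim s1 s2 k.*2.+2 r - wlim s1 s2 k.*2.+1 r) @[k --> \oo] -->
    \sum_(r < M) (u r - v r).
  apply: (@cvg_big _ _ +%R); first exact: add_continuous.
  move=> r _; apply: cvgB; last exact: vl.
  by rewrite (cvg_shiftS (fun k => wlim s1 s2 k.*2 r)); exact: ul.
near=> k; apply/ltW; near: k.
exact: (cvgr_lt _ h1).
Unshelve. all: by end_near. Qed.

(** Complement to [window_gap], whose bound has [s1 * s2] in the denominator: for small ratios the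
    iterates are simply close to 1. *)
Lemma window_gap_small k :
  \sum_(r < M) (wlim s1 s2 k.*2.+2 r - wlim s1 s2 k.*2.+1 r) <= M%:R * (s2 * phi M).
Proof.
rewrite -[X in X%:R * _](card_ord M); apply: (@sum_le_card _ _ xpredT) => r _.
have h1 := wlim_le1 k.*2.+2 r.
have h2 : 1 - s2 * phi M <= wlim s1 s2 k.*2.+1 r.
  rewrite [leRHS]/= odd_double.
  apply: le_trans (expR_ge1Dx _); rewrite lerD2l lerN2 ler_wpM2l //.
  have := @sum_kap_le _ M _ phi0 phi_homo r (wlim s1 s2 k.*2) 1 ler01 (wlim_le1 _).
  by rewrite mulr1.
lra.
Qed.

Lemma xlim_window s s' k : s1 <= s <= s2 -> s1 <= s' <= s2 ->
  xlim M phi s k.*2.+1 - xlim M phi s' k.*2.+2 <=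
  \sum_(r < M) (wlim s1 s2 k.*2.+2 r - wlim s1 s2 k.*2.+1 r).
Proof.
move=> hs hs'; rewrite /xlim -sumrB; apply: ler_sum => r _.
have := plim_window k.*2.+1 hs; rewrite oddS odd_double => /(_ r) h1.
have := plim_window k.*2.+2 hs'; rewrite !oddS odd_double => /(_ r) h2.
lra.
Qed.

End Window.

End FixedPoint.

(** * The power kernel, and uniformity in the ratio [s] *)

Section PowerKernel.
Variables (R : realType) (d theta : R).
Hypotheses (d_ge1 : 1 <= d) (theta_gt0 : 0 < theta).

Definition powphi (M m : nat) : R := (theta / M%:R * m%:R) `^ d.

Let d_gt0 : 0 < d. Proof. exact: lt_le_trans d_ge1. Qed.

Let scale_ge0 M m : 0 <= theta / M%:R * m%:R.
Proof. by rewrite mulr_ge0 // divr_ge0 // ltW. Qed.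

Lemma powphi0 M : powphi M 0 = 0.
Proof. by rewrite /powphi mulr0 powR0 // gt_eqF. Qed.

Lemma powphi_homo M : {homo powphi M : a b / (a <= b)%N >-> a <= b}.
Proof.
move=> a b ab; apply: ge0_ler_powR; rewrite ?nnegrE ?scale_ge0 ?(ltW d_gt0) //.
by rewrite ler_wpM2l ?divr_ge0 ?(ltW theta_gt0) // ler_nat.
Qed.

Lemma powphiM M : (0 < M)%N -> powphi M M = theta `^ d.
Proof. by move=> M0; rewrite /powphi divfK // pnatr_eq0 -lt0n. Qed.

(** Convexity of [x ^ d], tested at the midpoint of two points that lie two steps apart. *)
Lemma kap_powphi_homo M : {homo kap (powphi M) : a b / (a <= b)%N >-> a <= b}.
Proof.
apply: homo_leq => [x|y x z|m]; first exact: lexx.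
  exact: le_trans.
case: m => [|m]; first by rewrite /kap /= subrr subr_ge0 powphi_homo.
rewrite /kap /= lerBlDr addrAC lerBrDr.
pose c := theta / M%:R; have c0 : 0 <= c by rewrite divr_ge0 // ltW.
have h2 : 0 <= (2^-1 : R) <= 1 by rewrite invr_ge0 ler0n invf_le1 // ler1n.
have := convex_powR d_ge1 (Itv01 (proj1 (andP h2)) (proj2 (andP h2))).
move=> /(_ (c * m.+2%:R) (c * m%:R)).
rewrite !inE /= !in_itv /= !andbT !scale_ge0 => /(_ isT isT).
rewrite convRE [X in X `^ _ <= _]convRE /= /powphi -/c /unstable.onem.
have -> : 2^-1 * (c * m.+2%:R) + (1 - 2^-1) * (c * m%:R) = c * m.+1%:R.
  by rewrite -!natr1; field.
lra.
Qed.

Lemma powphi_ge M J m : (0 < M)%N -> (0 < J)%N -> (M < m * J)%N -> (theta / J%:R) `^ d <= powphi M m.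
Proof.
move=> M0 J0 mJ.
apply: ge0_ler_powR; rewrite ?nnegrE ?scale_ge0 ?(ltW d_gt0) // ?divr_ge0 ?(ltW theta_gt0) //.
rewrite -mulrA ler_wpM2l ?(ltW theta_gt0) // mulrC ler_pdivlMr ?ltr0n //.
by rewrite mulrC ler_pdivrMr ?ltr0n // -natrM ler_nat ltnW.
Qed.

Lemma kap_powphi_small e : 0 < e ->
  exists M0, forall M, (M0 <= M)%N -> kap (powphi M) M <= e.
Proof.
move=> e0.
have cont : {for theta, continuous (fun x : R => x `^ d)}.
  apply: differentiable_continuous; apply/derivable1_diffP.
  exact: (@ex_derive _ _ _ _ _ _ _ (is_derive1_powR d theta_gt0)).
have /cvgrPdist_lt /(_ e e0) [r /= r0 hr] := cont.
exists (Num.truncn (theta / r)).+1 => M M0M.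
have M0 : (0 < M)%N by apply: leq_trans M0M.
have rM : theta / M%:R < r.
  rewrite ltr_pdivrMr ?ltr0n // mulrC -ltr_pdivrMr //.
  by apply: lt_le_trans (truncnS_gt _) _; rewrite ler_nat.
have E : theta / M%:R * M.-1%:R = theta - theta / M%:R.
  by rewrite -subn1 natrB // mulrBr mulr1 divfK // pnatr_eq0 -lt0n.
rewrite /kap powphiM // /powphi E; apply/ltW/(le_lt_trans (ler_norm _)).
by apply: hr; rewrite /= opprB addrC subrK ger0_norm // divr_ge0 // ltW.
Qed.

(** The range [[0, 2]] is covered by finitely many windows of width [2 * eta] starting at multiples
    of [eta], so one depth [k] serves all of them and any two ratios at distance at most [eta] share
    a window. Windows starting below [sg] use [window_gap_small], the others [window_gap]. *)
Lemma replica_symmetry (e : R) : 0 < e ->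
  exists2 eta : R, 0 < eta & exists M0, forall M, (M0 <= M)%N -> (0 < M)%N ->
    \forall k \near \oo, forall s s' : R, 0 <= s <= 2 -> 0 <= s' <= 2 -> `|s - s'| <= eta ->
      xlim M (powphi M) s k.*2.+1 - xlim M (powphi M) s' k.*2.+2 <= M%:R * e.
Proof.
move=> e0.
(* Budget in units of [M]: [e / 4] from [J], [e / 4] from the width of a window, [e / 8] from
   [kap (powphi M) M]. The value of [sg] suits [window_gap_small], since a window starting below
   [sg] ends below [2 * sg]. *)
pose J := (Num.truncn (4 / e)).+1.
have J0 : 0 < J%:R :> R by rewrite ltr0n.
have Je : J%:R^-1 <= e / 4.
  rewrite -[e / 4]invrK invf_div lef_pV2 ?posrE ?divr_gt0 //; exact/ltW/truncnS_gt.
pose P := theta `^ d; have P0 : 0 < P by exact: powR_gt0.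
pose b := (theta / J%:R) `^ d; have b0 : 0 < b by apply: powR_gt0; rewrite divr_gt0.
pose sg := e / (2 * P); have sg0 : 0 < sg by rewrite divr_gt0 // mulr_gt0.
have sgE : 2 * sg * P = e by rewrite /sg; field; rewrite gt_eqF.
pose C := expR (3 * P) / (sg ^+ 2 * b).
have C0 : 0 < C by rewrite divr_gt0 ?expR_gt0 // mulr_gt0 ?exprn_gt0.
have CE : expR (3 * P) / (sg ^+ 2 * b) = C by [].
clearbody C sg.
pose eta := Num.min (2^-1) (Num.min (sg / 2) (e / (8 * C))).
have eta0 : 0 < eta.
  by rewrite !lt_min invr_gt0 ltr0n /= !divr_gt0 // mulr_gt0.
have eta1 : eta <= 2^-1 by rewrite ge_min lexx.
have eta2 : 2 * eta <= sg by rewrite mulrC -ler_pdivlMr // !ge_min lexx orbT.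
have eta3 : 2 * eta * C <= e / 4.
  have : eta <= e / (8 * C) by rewrite !ge_min lexx !orbT.
  rewrite ler_pdivlMr ?mulr_gt0 // => h.
  have -> : 2 * eta * C = eta * (8 * C) / 4 by field.
  by rewrite ler_wpM2r.
clearbody eta.
have [M0 hM0] := @kap_powphi_small (e / (72 * C)) (divr_gt0 e0 (mulr_gt0 (ltr0n _ 72) C0)).
exists eta => //; exists M0 => M M0M Mgt0.
have MR0 : 0 < M%:R :> R by rewrite ltr0n.
have kapM : 9 * kap (powphi M) M * C <= e / 8.
  have := hM0 _ M0M; rewrite ler_pdivlMr ?mulr_gt0 // => h.
  have -> : 9 * kap (powphi M) M * C = kap (powphi M) M * (72 * C) / 8 by field.
  by rewrite ler_wpM2r.
have phi0 := powphi0 M; have homo := @powphi_homo M; have khomo := @kap_powphi_homo M.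
pose K := (Num.truncn (2 / eta)).+1.
pose lo (j : nat) : R := j%:R * eta; pose hi (j : nat) : R := lo j.+2.
have lo0 j : 0 <= lo j by rewrite mulr_ge0 // ltW.
have hilo j : hi j = lo j + 2 * eta by rewrite /hi /lo -addn2 natrD mulrDl.
have lohi j : lo j <= hi j by rewrite hilo lerDl mulr_ge0 // ltW.
have loE j : lo j = j%:R * eta by [].
clearbody hi; clearbody lo.
have near_j (j : 'I_K) : \forall k \near \oo, \sum_(r < M)
    (wlim M (powphi M) (lo j) (hi j) k.*2.+2 r - wlim M (powphi M) (lo j) (hi j) k.*2.+1 r)
    <= M%:R * e.
  have hi3 : hi j <= 3.
    have : lo j <= 2.
      have : (Num.truncn (2 / eta))%:R <= 2 / eta by rewrite truncn_le divr_ge0 // ltW.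
      by rewrite loE -ler_pdivlMr //; apply: le_trans; rewrite ler_nat -ltnS.
    by rewrite hilo; lra.
  have [small|big] := ltP (lo j) sg.
    near=> k; apply: le_trans (window_gap_small M phi0 homo (lo0 j) (lohi j) k) _.
    rewrite ler_wpM2l // powphiM // -/P.
    by rewrite -sgE; apply: ler_wpM2r; [exact: ltW|rewrite hilo; lra].
  have lopos : 0 < lo j by exact: lt_le_trans big.
  apply: (window_gap phi0 homo khomo (lo0 j) (lohi j) (J := J) (b := b)) => //.
    by move=> m; apply: powphi_ge.
  rewrite ltr_pM2l // powphiM // -/P hilo [lo j + _ - lo j]addrAC subrr add0r.
  have k0 : 0 <= kap (powphi M) M by apply: kap_ge0.
  have : (2 * eta + 9 * kap (powphi M) M) * expR (3 * P) / (lo j * (lo j + 2 * eta) * b) <=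
     (2 * eta + 9 * kap (powphi M) M) * C.
    rewrite -mulrA -CE ler_wpM2l //; first by rewrite addr_ge0 // mulr_ge0 // ltW.
    rewrite ler_wpM2l ?expR_ge0 // lef_pV2 ?posrE ?mulr_gt0 ?exprn_gt0 //; last first.
      by rewrite addr_gt0 // mulr_gt0.
    rewrite ler_wpM2r ?(ltW b0) // expr2; apply: ler_pM; rewrite ?(ltW sg0) //.
    by apply: le_trans big _; rewrite lerDl mulr_ge0 // ltW.
  by rewrite mulrDl; lra.
near=> k; move=> s s' /andP[s0 s2] /andP[s'0 s'2] ss'.
have hk : forall j : 'I_K, \sum_(r < M)
    (wlim M (powphi M) (lo j) (hi j) k.*2.+2 r - wlim M (powphi M) (lo j) (hi j) k.*2.+1 r)
    <= M%:R * e by near: k; exact: filter_forall.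
pose t := Num.min s s'; have t0 : 0 <= t by rewrite le_min s0.
pose j := Num.truncn (t / eta).
have /andP[jt tj] : j%:R <= t / eta < j.+1%:R by apply: truncn_itv; rewrite divr_ge0 // ltW.
have jK : (j < K)%N by rewrite ltnS; apply: le_truncn; rewrite ler_wpM2r ?invr_ge0 ?(ltW eta0) // ge_min s2.
rewrite ler_pdivlMr // in jt; rewrite ltr_pdivrMr // in tj.
have tE : t <= s /\ t <= s' by rewrite !ge_min !lexx orbT.
have [ts ts'] := tE.
have tt : s <= t + eta /\ s' <= t + eta.
  move: ss'; rewrite ler_norml /t; case: (leP s s') => _ /andP[h1 h2]; split; lra.
have [st s't] := tt.
have hiE' : lo j.+1 + eta = hi j by rewrite hilo !loE -natr1; ring.
rewrite -loE in jt; rewrite -loE in tj.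
apply: le_trans (hk (Ordinal jK)).
by apply: (xlim_window M homo (lo0 j)) => //; apply/andP; split => /=; lra.
Unshelve. all: by end_near. Qed.

End PowerKernel.

(** * Discretised edge lengths *)

Section ExponentialTail.
Variable R : realType.

Lemma exponential_prob_itvcy (a : R) : 0 <= a ->
  exponential_prob 1 `[a, +oo[ = (expR (- a))%:E.
Proof.
move=> a0; rewrite /exponential_prob.
have cont : continuous (fun z : R => expR (- 1 * z)).
  move=> z; apply: continuous_comp; last exact: continuous_expR.
  by apply: continuousM => //; apply: (@continuousN _ R^o); exact: cst_continuous.
rewrite (@ge0_continuous_FTC2y _ _ (fun x => - (expR (- 1 * x))) _ 0)//.
- by rewrite mulN1r sub0e EFinN oppeK.
- by move=> x _; apply: exponential_pdf_ge0.
- apply: (@continuous_subspaceW R^o _ _ [set` `[0, +oo[%R]).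
    by apply: subset_itvr; rewrite bnd_simp.
  exact: within_continuous_exponential_pdf.
- rewrite -oppr0; apply: cvgN.
  rewrite (_ : (fun x => expR (- 1 * x)) = (fun z => expR (- z))); last first.
    by apply/funext => x; rewrite mulN1r.
  exact: cvgr_expR.
- by apply: cvgN; apply/cvg_at_right_filter; exact: cont.
- move=> x; rewrite in_itv/= andbT => ax; apply: derive1_exponential_pdf.
  by rewrite in_itv/= andbT (le_lt_trans a0).
Qed.

(** Events defined through [level] are intervals only within the half-line, because [powR] takes
    conventional values at negative arguments; the law puts no mass on those. *)
Lemma exponential_prob_ge0 (A : set R) : measurable A ->
  exponential_prob 1 A = exponential_prob 1 (A `&` [set` `[0, +oo[ ]).
Proof.
move=> mA.
pose mu0 := (@exponential_prob R 1 : probability _ R).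
pose mu := mu0 ltr01.
pose D : set R := [set` `[0, +oo[ ]; have mD : measurable D by exact: measurable_itv.
rewrite -/D -[LHS]/(mu A) -[RHS]/(mu (A `&` D)).
have mu1 : mu D = 1%E by rewrite /mu /mu0 /= exponential_prob_itvcy // oppr0 expR0.
have m0 : mu (~` D) = 0%E by rewrite probability_setC // mu1 subee.
rewrite -[in LHS](setIT A) -(setUv D) setIUr measureU //; last 3 first.
- exact: measurableI.
- by apply: measurableI => //; exact: measurableC.
- by rewrite setIACA setICr setI0.
rewrite -[RHS]adde0; congr (_ + _)%E.
apply/eqP; rewrite eq_le measure_ge0 andbT -m0.
by apply: le_measure; rewrite ?inE //; [apply: measurableI => // |]; apply: measurableC.
Qed.

End ExponentialTail.

(** * The joint law of the rounded savings *)

Section Levels.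
Variables (R : realType) (d theta lam : R) (M n : nat).
Hypotheses (d_ge1 : 1 <= d) (theta_gt0 : 0 < theta) (lam_gt0 : 0 < lam).
Hypotheses (M_gt0 : (0 < M)%N) (n_gt0 : (0 < n)%N).

Let d_gt0 : 0 < d. Proof. exact: lt_le_trans d_ge1. Qed.
Let MR_gt0 : 0 < M%:R :> R. Proof. by rewrite ltr0n. Qed.
Let nR_gt0 : 0 < n%:R :> R. Proof. by rewrite ltr0n. Qed.

Lemma ler_powR2 (p a b : R) : 0 < p -> 0 <= a -> 0 <= b -> (a `^ p <= b `^ p) = (a <= b).
Proof.
move=> p0 a0 b0; apply/idP/idP => [|ab]; last first.
  by apply: ge0_ler_powR; rewrite ?nnegrE // ltW.
by apply: contraLR; rewrite -!ltNge => ba; apply: gt0_ltr_powR; rewrite ?nnegrE.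
Qed.

(* The saving [theta - lam * l], rounded up to a multiple of [theta / M] and truncated
   at 0, in units of [theta / M]. *)
Definition level_of_length (l : R) : nat := (M - Num.truncn (lam * l / (theta / M%:R)))%N.

Definition level (x : R) : nat := level_of_length ((n%:R * x) `^ d^-1).

(** Multiplying a length [(n * x) ^ (1 / d)] by [lam] amounts to replacing [n] by this number, which
    plays the part of [N] in the finite model. *)
Definition rate : R := n%:R * lam `^ d.

Definition level_cdf (b : nat) : R := expR (- (powphi d theta M (M - b) / rate)).

Lemma rate_gt0 : 0 < rate.
Proof. by rewrite mulr_gt0 // powR_gt0. Qed.

Lemma level_leM x : (level x <= M)%N.
Proof. exact: leq_subr. Qed.

Lemma level_leE x b : (b < M)%N ->
  (level x <= b)%N = ((M - b)%:R <= lam * (n%:R * x) `^ d^-1 / (theta / M%:R)).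
Proof.
move=> bM; rewrite /level /level_of_length leq_subLR addnC -leq_subLR.
by rewrite -(prednK (n := (M - b)%N)) ?subn_gt0 // truncn_gt_nat.
Qed.

Lemma level_le_itv b : (b < M)%N ->
  [set x | (level x <= b)%N] `&` [set` `[0, +oo[ ] =
  [set` `[powphi d theta M (M - b) / rate, +oo[ ].
Proof.
move=> bM; apply/seteqP; split=> x /=; rewrite !in_itv /= !andbT;
  have E : lam `^ d * (n%:R * x) = x * rate by rewrite /rate; ring.
  move=> [h x0]; move: h; rewrite level_leE //.
  rewrite ler_pdivlMr ?divr_gt0 // mulrC -(ler_powR2 d_gt0) ?mulr_ge0 ?divr_ge0 ?powR_ge0 ?(ltW theta_gt0) ?(ltW lam_gt0) //.
  rewrite powRM ?powR_ge0 ?(ltW lam_gt0) // -powRrM mulVf ?gt_eqF // powRr1 ?mulr_ge0 //.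
  by rewrite ler_pdivrMr ?rate_gt0 // E.
move=> h; have x0 : 0 <= x.
  by apply: le_trans h; rewrite divr_ge0 ?powR_ge0 // ltW // rate_gt0.
split=> //; rewrite level_leE //.
rewrite ler_pdivlMr ?divr_gt0 // mulrC -(ler_powR2 d_gt0) ?mulr_ge0 ?divr_ge0 ?powR_ge0 ?(ltW theta_gt0) ?(ltW lam_gt0) //.
rewrite powRM ?powR_ge0 ?(ltW lam_gt0) // -powRrM mulVf ?gt_eqF // powRr1 ?mulr_ge0 //.
by move: h; rewrite ler_pdivrMr ?rate_gt0 // E.
Qed.

Lemma measurable_level_le b : measurable [set x | (level x <= b)%N].
Proof.
have [Mb|bM] := leqP M b.
  rewrite (_ : [set x | _] = setT) //; apply/seteqP; split=> // x _ /=.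
  exact: leq_trans (level_leM x) Mb.
rewrite (_ : [set x | _] = [set x | (M - b)%:R <= lam * (n%:R * x) `^ d^-1 / (theta / M%:R)]).
  rewrite -[X in measurable X]setTI.
  apply: (@measurable_fun_le _ _ R setT) => //.
  apply: measurable_funM => //; apply: measurable_funM => //.
  exact: (measurableT_comp (measurable_powR d^-1) (mulrl_measurable n%:R)).
by apply/seteqP; split=> x /=; rewrite level_leE.
Qed.

Lemma exponential_level_le b :
  exponential_prob 1 [set x : R | (level x <= b)%N] = (level_cdf b)%:E.
Proof.
rewrite exponential_prob_ge0; last exact: measurable_level_le.
have [Mb|bM] := leqP M b.
  rewrite (_ : [set x | _] = setT); last first.
    by apply/seteqP; split=> // x _ /=; exact: leq_trans (level_leM x) Mb.
  rewrite setTI exponential_prob_itvcy // /level_cdf (eqP (_ : (M - b)%N == 0%N)) ?subn_eq0 //.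
  by rewrite powphi0 // mul0r.
by rewrite level_le_itv // exponential_prob_itvcy // divr_ge0 ?powR_ge0 // ltW // rate_gt0.
Qed.

Lemma level_cdf_le a b : (a <= b)%N -> level_cdf a <= level_cdf b.
Proof.
move=> ab; rewrite ler_expR lerN2 ler_wpM2r ?invr_ge0 ?(ltW rate_gt0) //.
by apply: powphi_homo => //; exact: leq_sub2l.
Qed.

Definition level_mass (j : nat) : R := level_cdf j - (if j is j'.+1 then level_cdf j' else 0).

(** Pairs that are not edges receive the level 0 almost surely, so that the configuration over all
    ordered pairs is still a product of probability laws. *)
Definition edge_mass (e : 'I_n * 'I_n) (j : 'I_M.+1) : R :=
  if is_edge e then level_mass j else (j == ord0)%:R.

Lemma level_mass_ge0 j : 0 <= level_mass j.
Proof. by case: j => [|j]; rewrite /level_mass ?subr0 ?expR_ge0 // subr_ge0 level_cdf_le. Qed.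

Lemma sum_level_mass b : \sum_(j < b.+1) level_mass j = level_cdf b.
Proof.
elim: b => [|b IHb]; first by rewrite big_ord_recr big_ord0 /= add0r /level_mass subr0.
by rewrite big_ord_recr /= IHb /level_mass addrC subrK.
Qed.

Lemma level_cdfM b : (M <= b)%N -> level_cdf b = 1.
Proof.
move=> Mb; rewrite /level_cdf (eqP (_ : (M - b)%N == 0%N)) ?subn_eq0 //.
by rewrite powphi0 // mul0r oppr0 expR0.
Qed.

Lemma edge_mass_ge0 e j : 0 <= edge_mass e j.
Proof. by rewrite /edge_mass; case: ifP => // _; exact: level_mass_ge0. Qed.

Lemma edge_mass_sum1 e : \sum_j edge_mass e j = 1.
Proof.
rewrite /edge_mass; case: (is_edge e); first by rewrite sum_level_mass level_cdfM.
by rewrite (bigD1 ord0) //= big1 ?addr0 // => j /negbTE ->.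
Qed.

Lemma edge_mass_cdf e b : is_edge e -> lower_mass edge_mass e b = level_cdf b.
Proof.
move=> ee; rewrite /lower_mass /edge_mass ee.
have [Mb|bM] := leqP M b.
  rewrite (eq_bigl xpredT) ?sum_level_mass ?level_cdfM // => j /=.
  by rewrite (leq_trans _ Mb) // -ltnS ltn_ord.
rewrite -sum_level_mass (big_ord_widen M.+1 level_mass) ?ltnS ?(ltnW bM) //.
Qed.

Definition level_config (x : 'I_n -> 'I_n -> R) : {ffun 'I_n * 'I_n -> 'I_M.+1} :=
  [ffun e => if is_edge e then inord (level (x e.1 e.2)) else ord0].

Section Transfer.
Variables (dT : measure_display) (T : measurableType dT) (P : probability T R).
Variable X : 'I_n -> 'I_n -> T -> R.
Hypothesis X_meas : forall i j : 'I_n, (i < j)%N -> measurable_fun setT (X i j).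
Hypothesis X_law : forall i j : 'I_n, (i < j)%N ->
  forall A : set R, measurable A -> P (X i j @^-1` A) = exponential_prob 1 A.
Hypothesis X_indep : edges_independent P (fun e => X e.1 e.2).

Local Notation cfg := (fun w => level_config (fun i j => X i j w)).

Let cell (j : nat) : set R := [set x | level x = j].

Lemma cellE j : cell j = [set x | (level x <= j)%N] `\`
  (if j is j'.+1 then [set x | (level x <= j')%N] else set0).
Proof.
apply/seteqP; split=> x; rewrite /cell /=.
  by case: j => [|j] E; (split; first by rewrite E) => //=; rewrite E ltnn.
by case: j => [|j] /= [h1 h2]; apply/eqP; rewrite eqn_leq h1 //= ltnNge; apply/negP.
Qed.

Lemma measurable_cell j : measurable (cell j).
Proof.
rewrite cellE; apply: measurableD; first exact: measurable_level_le.
by case: j => [|j]; [exact: measurable0|exact: measurable_level_le].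
Qed.

Lemma prob_cell (i k : 'I_n) (j : nat) : (i < k)%N ->
  P (X i k @^-1` cell j) = (level_mass j)%:E.
Proof.
move=> ik; have mX (A : set R) : measurable A -> measurable (X i k @^-1` A).
  by move=> mA; rewrite -[_ @^-1` _]setTI; exact: X_meas.
pose A := [set x : R | (level x <= j)%N].
pose B : set R := if j is j'.+1 then [set x | (level x <= j')%N] else set0.
have mA : measurable A by exact: measurable_level_le.
have mB : measurable B by rewrite /B; case: (j) => [|j']; [exact: measurable0|exact: measurable_level_le].
have BA : B `<=` A by rewrite /A /B; case: (j) => [|j'] x //=; exact: leqW.
have -> : X i k @^-1` cell j = X i k @^-1` A `\` X i k @^-1` B by rewrite cellE.
rewrite measureD; [|exact: mX|exact: mX|]; last first.
  by apply: le_lt_trans (probability_le1 _ _) _; rewrite ?ltry //; exact: mX.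
rewrite (setIidr (preimage_subset BA)).
transitivity (exponential_prob 1 A - exponential_prob 1 B)%E.
  by congr (_ - _)%E; exact: X_law.
rewrite exponential_level_le /level_mass EFinB.
congr (_ - _)%E; rewrite /B; case: (j) => [|j']; last exact: exponential_level_le.
by rewrite /exponential_prob integral_set0.
Qed.

Lemma level_config_preimage (v : {ffun 'I_n * 'I_n -> 'I_M.+1}) :
  (forall e, ~~ is_edge e -> v e = ord0) ->
  cfg @^-1` [set v] =
  \big[setI/setT]_(e in [set e | is_edge e]%SET) ((fun w => X e.1 e.2 w) @^-1` cell (v e)).
Proof.
move=> v0; rewrite -bigcap_seq_cond; apply/seteqP; split=> w /=.
  move=> <- e /=; rewrite mem_index_enum inE /= => ee; rewrite /cell /= ffunE ee.
  by rewrite inordK // ltnS level_leM.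
move=> h; apply/ffunP => e; rewrite ffunE; case: ifPn => [ee|/v0 //].
have := h e; rewrite /= mem_index_enum inE /= => /(_ ee) /=; rewrite /cell /= => ->.
by apply: val_inj; rewrite /= inordK.
Qed.

Lemma measurable_config (v : {ffun 'I_n * 'I_n -> 'I_M.+1}) :
  measurable (cfg @^-1` [set v]).
Proof.
have [/forallP v0|] := boolP [forall e, ~~ is_edge e ==> (v e == ord0)].
  rewrite level_config_preimage => [|e ee]; last by apply/eqP; have := v0 e; rewrite ee.
  apply: bigsetI_measurable => e; rewrite inE => ee.
  by rewrite -[_ @^-1` _]setTI; apply: X_meas => //; exact: measurable_cell.
rewrite negb_forall => /existsP[e]; rewrite negb_imply => /andP[ee ve].
rewrite (_ : _ @^-1` _ = set0) //; apply/seteqP; split=> w //= wv.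
by move: ve; rewrite -wv ffunE (negbTE ee) eqxx.
Qed.

Lemma prob_config (v : {ffun 'I_n * 'I_n -> 'I_M.+1}) :
  P (cfg @^-1` [set v]) = (pweight edge_mass v)%:E.
Proof.
have [/forallP v0|] := boolP [forall e, ~~ is_edge e ==> (v e == ord0)].
  rewrite level_config_preimage => [|e ee]; last by apply/eqP; have := v0 e; rewrite ee.
  have /= -> := X_indep (F := [set e | is_edge e]%SET) (B := fun e => cell (v e)) _ _.
  - rewrite /pweight -prodEFin [RHS](bigID (@is_edge n)) /= [X in (_ * X)%E]big1 ?mule1.
      apply: eq_big => [e|e]; first by rewrite inE.
      by rewrite inE => ee; rewrite prob_cell // /edge_mass ee.
    move=> e ee; have := v0 e; rewrite ee /edge_mass (negbTE ee) => /eqP ->.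
    by rewrite eqxx.
  - by apply/fintype.subsetP => e; rewrite !inE.
  - by move=> e; exact: measurable_cell.
rewrite negb_forall => /existsP[e]; rewrite negb_imply => /andP[ee ve].
rewrite (_ : _ @^-1` _ = set0); last first.
  apply/seteqP; split=> w //= wv.
  by move: ve; rewrite -wv ffunE (negbTE ee) eqxx.
rewrite measure0 /pweight (bigD1 e) //= /edge_mass (negbTE ee) (negbTE ve).
by rewrite mul0r.
Qed.

Lemma config_bigsetU (Q : pred {ffun 'I_n * 'I_n -> 'I_M.+1}) :
  [set w | Q (cfg w)] = \big[setU/set0]_(v | Q v) cfg @^-1` [set v].
Proof.
rewrite -bigcup_seq_cond; apply/seteqP; split=> w /=.
  by move=> Qw; exists (cfg w) => //=; rewrite mem_index_enum.
by move=> [v /=]; rewrite mem_index_enum /= => Qv ->.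
Qed.

Lemma measurable_config_pred (Q : pred {ffun 'I_n * 'I_n -> 'I_M.+1}) :
  measurable [set w | Q (cfg w)].
Proof. by rewrite config_bigsetU; apply: bigsetU_measurable => v _; exact: measurable_config. Qed.

Lemma prob_config_pred (Q : pred {ffun 'I_n * 'I_n -> 'I_M.+1}) :
  (P [set w | Q (cfg w)] <= (Ex edge_mass (fun v => (Q v)%:R))%:E)%E.
Proof.
have -> : Ex edge_mass (fun v => (Q v)%:R) = \sum_(v | Q v) pweight edge_mass v.
  rewrite /Ex [RHS]big_mkcond; apply: eq_bigr => v _.
  by case: (Q v); rewrite ?mulr1 ?mulr0.
rewrite -sumEFin config_bigsetU.
under [leRHS]eq_bigr do rewrite -prob_config.
apply: (proj2 (A := measurable (\big[setU/set0]_(v | Q v) cfg @^-1` [set v]))).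
elim/big_rec2: _ => [|v y A Qv [mA ih]]; first by rewrite measure0.
split; first by apply: measurableU => //; exact: measurable_config.
apply: (@le_trans _ _ (P (cfg @^-1` [set v]) + P A)%E); last by rewrite leeD2l.
exact: (measureU2 P (measurable_config v) mA).
Qed.

End Transfer.

End Levels.

(** * From the diluted cost to maximal weights, and measurability of the optimum *)

Section DilutedCost.
Variables (R : realType) (n : nat).
Implicit Types (l : 'I_n -> 'I_n -> R) (m : {set 'I_n * 'I_n}).

Lemma covered_sum m (v : 'I_n) : is_matching m ->
  nat_of_bool (covered m v) = (\sum_(e in m) ((v == e.1) + (v == e.2)))%N.
Proof.
move=> /matchingP[h1 h2]; rewrite /covered; case: existsP => [[e /andP[em ve]]|nv].
  rewrite (bigD1 e) //= big1 ?addn0.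
    have := h1 e em; rewrite /is_edge; case/orP: ve => /eqP ->; rewrite eqxx.
      by rewrite -val_eqE /=; case: ltngtP.
    by rewrite -[e.2 == e.1]val_eqE /=; case: ltngtP.
  move=> f /andP[fm fe]; have := h2 e f em fm; rewrite eq_sym fe => /(_ isT) /and4P[].
  by case/orP: ve => /eqP -> a b c d; apply/eqP; rewrite addn_eq0 !eqb0 ?a ?b ?c ?d.
apply/esym/eqP; rewrite sum_nat_eq0; apply/forall_inP => e em.
rewrite addn_eq0 !eqb0 -negb_or; apply/negP => ve; apply: nv; exists e.
by rewrite em.
Qed.

Lemma card_uncovered m : is_matching m ->
  (#|[set v | ~~ covered m v]| + 2 * #|m| = n)%N.
Proof.
move=> hm; have -> : (2 * #|m| = #|[pred v | covered m v]|)%N.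
  have -> : #|[pred v | covered m v]| = (\sum_v nat_of_bool (covered m v))%N.
    by rewrite -sum1_card big_mkcond; apply: eq_bigr => v _; rewrite inE; case: (covered m v).
  under [RHS]eq_bigr do rewrite covered_sum //.
  rewrite exchange_big /= (eq_bigr (fun=> 2%N)); last first.
    have one (u : 'I_n) : (\sum_(v < n) (v == u) = 1)%N.
      by rewrite (bigD1 u) //= eqxx big1 // => v /negbTE ->.
    by move=> e _; rewrite big_split /= !one.
  by rewrite sum_nat_const mulnC.
rewrite -[RHS](card_ord n) addnC -(cardC [pred v | covered m v]); congr (_ + _)%N.
by apply: eq_card => v; rewrite !inE /=; apply/idP/idP; rewrite inE.
Qed.

Lemma card_matching_le m : is_matching m -> (#|m| <= n)%N.
Proof. by move=> /card_uncovered; lia. Qed.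

Lemma dm_cost_gain l theta m : is_matching m ->
  dm_cost l theta m = n%:R * theta / 2 - \sum_(e in m) (theta - l e.1 e.2).
Proof.
move=> hm.
have E : n%:R = #|[set v | ~~ covered m v]|%:R + 2 * #|m|%:R :> R.
  by rewrite -natrM -natrD card_uncovered.
by rewrite /dm_cost sumrB sumr_const E -[theta *+ _]mulr_natl; field.
Qed.

Lemma opt_dmP l theta : is_matching (opt_dm l theta) /\
  forall m, is_matching m -> \sum_(e in m) (theta - l e.1 e.2) <=
    \sum_(e in opt_dm l theta) (theta - l e.1 e.2).
Proof.
rewrite /opt_dm; case: arg_minP => [|m hm H]; first exact: is_matching0.
split=> // m' hm'; have := H m' hm'; rewrite !dm_cost_gain // lerD2l lerN2.
exact.
Qed.

Section Discretisation.
Variables (M : nat) (theta lam : R) (l : 'I_n -> 'I_n -> R) (x : 'I_n * 'I_n -> nat).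
Hypotheses (M_gt0 : (0 < M)%N) (theta_gt0 : 0 < theta) (lam_gt0 : 0 < lam).
Hypothesis l_ge0 : forall e : 'I_n * 'I_n, 0 <= l e.1 e.2.
Hypothesis xE : forall e, is_edge e -> x e = level_of_length theta lam M (l e.1 e.2).

Let delta : R := theta / M%:R.

Let delta_gt0 : 0 < delta. Proof. by rewrite divr_gt0 // ltr0n. Qed.

Let deltaM : delta * M%:R = theta.
Proof. by rewrite /delta divfK // pnatr_eq0 -lt0n. Qed.

Let ratio_ge0 e : 0 <= lam * l e.1 e.2 / delta.
Proof. by rewrite divr_ge0 ?mulr_ge0 // ltW. Qed.

Lemma saving_le_level e : is_edge e -> theta - lam * l e.1 e.2 <= delta * (x e)%:R.
Proof.
move=> ee; rewrite xE // /level_of_length -/delta.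
set t := Num.truncn _; have ht : delta * t%:R <= lam * l e.1 e.2.
  by rewrite mulrC -ler_pdivlMr // truncn_le.
have [tM|/ltnW Mt] := leqP t M.
  by rewrite natrB // mulrBr deltaM lerD2l lerN2.
rewrite (eqP (_ : (M - t)%N == 0%N)) ?subn_eq0 // mulr0 subr_le0.
by apply: le_trans ht; rewrite -deltaM ler_wpM2l ?(ltW delta_gt0) // ler_nat.
Qed.

Lemma level_le_saving e : is_edge e -> (0 < x e)%N ->
  delta * (x e)%:R <= theta - lam * l e.1 e.2 + delta.
Proof.
move=> ee; rewrite xE // /level_of_length -/delta.
set t := Num.truncn _; rewrite subn_gt0 => tM.
have ht : lam * l e.1 e.2 < delta * t.+1%:R.
  by rewrite [ltRHS]mulrC -ltr_pdivrMr //; exact: truncnS_gt.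
by rewrite natrB ?(ltnW tM) // mulrBr deltaM; move: ht; rewrite -natr1 mulrDr mulr1; lra.
Qed.

Lemma saving_le_max_weight m : is_matching m ->
  \sum_(e in m) (theta - lam * l e.1 e.2) <= delta * (max_weight x [set: 'I_n]%SET)%:R.
Proof.
move=> hm; apply: (@le_trans _ _ (\sum_(e in m) delta * (x e)%:R)).
  apply: ler_sum => e em; apply: saving_le_level; by case/matchingP: hm => h _; exact: h.
rewrite -mulr_sumr ler_wpM2l ?(ltW delta_gt0) // -natr_sum ler_nat.
by apply: max_weight_ge => //; apply/insideP => e _; rewrite !inE.
Qed.

(** Edges of level 0 are dropped, because the truncation hides how negative their true saving may
    be. Every other edge loses at most [delta] by rounding, and there are at most [n] of them. *)
Lemma max_weight_le_saving : exists2 m, is_matching m &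
  delta * (max_weight x [set: 'I_n]%SET)%:R <= \sum_(e in m) (theta - lam * l e.1 e.2) + delta * n%:R.
Proof.
have [m [hm _ ->]] := max_weight_ex x [set: 'I_n]%SET.
pose m' := [set e in m | (0 < x e)%N]%SET.
have m'm : m' \subset m by apply/fintype.subsetP => e; rewrite inE => /andP[].
have hm' : is_matching m' by exact: is_matchingS hm.
exists m' => //.
have -> : (\sum_(e in m) x e = \sum_(e in m') x e)%N.
  rewrite (bigID (fun e => 0 < x e)%N) /= [X in (_ + X)%N]big1 ?addn0.
    by apply: eq_bigl => e; rewrite inE.
  by move=> e /andP[_]; rewrite -eqn0Ngt => /eqP.
rewrite natr_sum mulr_sumr.
apply: (@le_trans _ _ (\sum_(e in m') (theta - lam * l e.1 e.2 + delta))).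
  apply: ler_sum => e em'; have := em'; rewrite inE => /andP[_ x0].
  by apply: level_le_saving => //; case/matchingP: hm' => h _; exact: h.
rewrite big_split /= lerD2l sumr_const -[delta *+ _]mulr_natr ler_wpM2l ?(ltW delta_gt0) // ler_nat.
exact: card_matching_le.
Qed.

End Discretisation.

(** The optimum for [lam = 1] competes at [lam], where it saves [(lam - 1) * opt_dm_length l theta]
    less. This is a lower bound on the length for [lam > 1] and, after division by a negative
    number, an upper bound for [lam < 1]. The term [n] is the rounding error. *)
Lemma opt_length_slope (M : nat) (theta lam : R) l (x1 xlam : 'I_n * 'I_n -> nat) :
  (0 < M)%N -> 0 < theta -> 0 < lam -> (forall e : 'I_n * 'I_n, 0 <= l e.1 e.2) ->
  (forall e, is_edge e -> x1 e = level_of_length theta 1 M (l e.1 e.2)) ->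
  (forall e, is_edge e -> xlam e = level_of_length theta lam M (l e.1 e.2)) ->
  theta / M%:R * ((max_weight x1 [set: 'I_n]%SET)%:R - (max_weight xlam [set: 'I_n]%SET)%:R - n%:R) <=
  (lam - 1) * opt_dm_length l theta.
Proof.
move=> M0 th0 lam0 l0 h1 hlam; have [hm opt] := opt_dmP l theta.
have [m hm' up] := max_weight_le_saving M0 th0 h1.
have lo := saving_le_max_weight M0 th0 lam0 l0 hlam hm.
have h3 := opt m hm'.
have E1 : \sum_(e in m) (theta - 1 * l e.1 e.2) = \sum_(e in m) (theta - l e.1 e.2).
  by apply: eq_bigr => e _; rewrite mul1r.
rewrite E1 in up.
rewrite !mulrBr.
have -> : (lam - 1) * opt_dm_length l theta = \sum_(e in opt_dm l theta) (theta - l e.1 e.2) -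
   \sum_(e in opt_dm l theta) (theta - lam * l e.1 e.2).
  rewrite /opt_dm_length -sumrB mulr_sumr; apply: eq_bigr => e _; ring.
lra.
Qed.

Section Measurability.
Variables (dT : measure_display) (T : measurableType dT) (l : T -> 'I_n -> 'I_n -> R).
Hypothesis l_meas : forall i j : 'I_n, (i < j)%N -> measurable_fun setT (fun w => l w i j).
Variable theta : R.

Lemma measurable_matching_length m : is_matching m ->
  measurable_fun setT (fun w => \sum_(e in m) l w e.1 e.2).
Proof.
move=> /matchingP[h1 _]; under eq_fun do rewrite big_mkcond.
apply: (@measurable_sum _ _ R setT _ (index_enum _)
  (fun e w => if e \in m then l w e.1 e.2 else 0)) => e.
case: (boolP (e \in m)) => [em|_]; last exact: measurable_cst.
by apply: l_meas; exact: h1.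
Qed.

Lemma measurable_dm_cost m : is_matching m ->
  measurable_fun setT (fun w => dm_cost (l w) theta m).
Proof.
move=> hm; apply: measurable_funD; first exact: measurable_matching_length.
exact: measurable_cst.
Qed.

Definition minimal_cost (w : T) m : bool := is_matching m &&
  [forall m', is_matching m' ==> (dm_cost (l w) theta m <= dm_cost (l w) theta m')].

Lemma opt_dm_pick w : opt_dm (l w) theta = odflt finset.set0 [pick m | minimal_cost w m].
Proof. by []. Qed.

Lemma measurable_minimal_cost m : measurable [set w | minimal_cost w m].
Proof.
have [hm|hm] := boolP (is_matching m); last first.
  rewrite (_ : [set w | _] = set0) //; apply/seteqP; split=> w //=.
  by rewrite /minimal_cost (negbTE hm).
rewrite (_ : [set w | _] = \big[setI/setT]_(m' | is_matching m')
    [set w | dm_cost (l w) theta m <= dm_cost (l w) theta m']).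
  apply: bigsetI_measurable => m' hm'; rewrite -[X in measurable X]setTI.
  by apply: measurable_fun_le => //; exact: measurable_dm_cost.
rewrite -bigcap_seq_cond; apply/seteqP; split=> w /=.
  move=> /andP[_ /forallP h] m' /=; rewrite mem_index_enum /= => hm'.
  by have := h m'; rewrite hm'.
move=> h; rewrite /minimal_cost hm; apply/forallP => m'; apply/implyP => hm'.
by apply: (h m'); rewrite /= mem_index_enum.
Qed.

(** Ties are harmless: the minimiser that is picked is a function [g] of the finite pattern
    recording which matchings have minimal cost, and each bit of the pattern is a measurable
    event. *)
Lemma measurable_opt_dm m : measurable [set w | opt_dm (l w) theta = m].
Proof.
pose b w : {ffun {set 'I_n * 'I_n} -> bool} := [ffun m => minimal_cost w m].
pose g (t : {ffun {set 'I_n * 'I_n} -> bool}) := odflt finset.set0 [pick m | t m].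
have gb w : opt_dm (l w) theta = g (b w).
  rewrite opt_dm_pick /g; congr (odflt _ _); apply: eq_pick => m'; by rewrite ffunE.
rewrite (_ : [set w | _] = \big[setU/set0]_(t | g t == m) (b @^-1` [set t])); last first.
  rewrite -bigcup_seq_cond; apply/seteqP; split=> w /=.
    by rewrite gb => h; exists (b w) => //=; rewrite mem_index_enum h eqxx.
  by move=> [t /=]; rewrite mem_index_enum /= => /eqP <- <-; rewrite gb.
apply: bigsetU_measurable => t _.
rewrite (_ : _ @^-1` _ = \big[setI/setT]_(m' : {set 'I_n * 'I_n}) [set w | minimal_cost w m' = t m']).
  apply: bigsetI_measurable => m' _; case: (t m'); first exact: measurable_minimal_cost.
  rewrite (_ : [set w | _] = ~` [set w | minimal_cost w m']).
    by apply: measurableC; exact: measurable_minimal_cost.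
  by apply/seteqP; split=> w /=; [move=> ->|move/negP/negbTE].
rewrite -bigcap_seq; apply/seteqP; split=> w /=.
  by move=> <- m' _; rewrite ffunE.
by move=> h; apply/ffunP => m'; rewrite ffunE; apply: h; rewrite /= mem_index_enum.
Qed.

Lemma measurable_opt_dm_length : measurable_fun setT (fun w => opt_dm_length (l w) theta).
Proof.
move=> _ A mA; rewrite setTI.
rewrite (_ : _ @^-1` A = \big[setU/set0]_(m : {set 'I_n * 'I_n} | is_matching m)
    ([set w | opt_dm (l w) theta = m] `&` ((fun w => \sum_(e in m) l w e.1 e.2) @^-1` A))).
  apply: bigsetU_measurable => m hm; apply: measurableI; first exact: measurable_opt_dm.
  by rewrite -[_ @^-1` _]setTI; exact: measurable_matching_length.
rewrite -bigcup_seq_cond; apply/seteqP; split=> w /=.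
  move=> h; exists (opt_dm (l w) theta) => //=.
  by rewrite mem_index_enum; case: (opt_dmP (l w) theta).
by move=> [m _ [<-]].
Qed.

End Measurability.

End DilutedCost.

(** * Convergence of the mean length *)

Section Antiderivative.
Variable R : realType.

Lemma antiderivative (f : R -> R) : continuous f ->
  exists2 G : R -> R, G 0 = 0 & forall a b, 0 <= a -> a <= b -> b <= 2 ->
    exists2 c, a <= c <= b & G b - G a = f c * (b - a).
Proof.
(* Working over [[-1, 3]] makes [F] differentiable at the end points 0 and 2 as well. *)
move=> cf; pose F x := (\int[lebesgue_measure]_(t in `[-1, x]) f t)%R.
have Fi : lebesgue_measure.-integrable `[-1, 3] (EFin \o f).
  apply: continuous_compact_integrable; first exact: segment_compact.
  exact: continuous_subspaceT.
have FD x : -1 < x -> x < 3 -> derivable F x 1 /\ F^`()%classic x = f x.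
  by move=> x1 x3; apply: (continuous_FTC1_closed x3 Fi x1); exact: cf.
exists (fun x => F x - F 0); first by rewrite subrr.
move=> a b a0 ab b2.
have dF x : x \in `]a, b[ -> is_derive x 1 F (f x).
  rewrite in_itv /= => /andP[ax xb].
  have [|| dx <-] := FD x; [lra|lra|].
  by rewrite derive1E; exact: derivableP.
have [|c] := MVT_segment ab dF.
  apply: derivable_within_continuous => x; rewrite in_itv /= => /andP[ax xb].
  by have [|| dx _] := FD x; [lra|lra|].
rewrite in_itv /= => cab E; exists c => //.
by rewrite -E; ring.
Qed.

End Antiderivative.

(** * Regularity of the mean gain, and its Riemann sums *)

Section XlimRegular.
Variables (R : realType) (M : nat) (phi : nat -> R).
Hypothesis phi0 : phi 0%N = 0.
Hypothesis phi_homo : {homo phi : a b / (a <= b)%N >-> a <= b}.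

Lemma continuous_plim k q : continuous (fun s => plim M phi s k q).
Proof.
elim: k q => [|k IHk] q s /=; first exact: cvg_cst.
apply: continuous_cvg; first exact: continuous_expR.
apply: cvgN; apply: cvgM; first exact: cvg_id.
apply: (@cvg_big _ _ +%R); first exact: add_continuous.
by move=> r _; apply: cvgM; [exact: cvg_cst|exact: IHk].
Qed.

Lemma continuous_xlim k : continuous (fun s => xlim M phi s k).
Proof.
move=> s; apply: (@cvg_big _ _ +%R); first exact: add_continuous.
by move=> r _; apply: cvgB; [exact: cvg_cst|exact: continuous_plim].
Qed.

Lemma xlim_lipschitz s s' k : 0 <= s <= 2 -> 0 <= s' <= 2 ->
  `|xlim M phi s k - xlim M phi s' k| <= M%:R * dep_cst M phi k * `|s - s'|.
Proof.
move=> hs hs'; rewrite /xlim -sumrB; apply: le_trans (ler_norm_sum _ _ _) _.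
rewrite -mulrA -[X in X%:R * _](card_ord M); apply: (@sum_le_card _ _ xpredT) => q _.
rewrite (_ : _ - _ = - (plim M phi s k q - plim M phi s' k q)); last by ring.
by rewrite normrN; exact: plim_lipschitz.
Qed.

Lemma xlim_bounds s k : 0 <= s -> 0 <= xlim M phi s k <= M%:R.
Proof.
move=> s0; apply/andP; split.
  by apply: sumr_ge0 => q _; rewrite subr_ge0 plim_le1.
rewrite -[leRHS]mulr1 -[X in X%:R * _](card_ord M); apply: (@sum_le_card _ _ xpredT) => q _.
by rewrite lerBlDr lerDl ltW // plim_gt0.
Qed.

Lemma xlim_even_le_odd s k : 0 <= s -> xlim M phi s k.*2.+2 <= xlim M phi s k.*2.+1.
Proof.
move=> s0; apply: ler_sum => q _; rewrite lerD2l lerN2.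
(* On the degenerate window from [s] to [s], [wlim] is [plim], so the monotonicity of its iterates
   carries over. *)
have E k' q' : plim M phi s k' q' = wlim M phi s s k' q'.
  elim: k' q' => [|k' IH] q' //=; rewrite if_same /expavg /avg.
  by congr (expR (- (s * _))); apply: eq_bigr => r _; rewrite IH.
rewrite !E; have := wlim_step M phi_homo s0 (lexx s) k.*2.+1.
by rewrite oddS odd_double; exact.
Qed.

(** The vertex inserted in position [j] sees the ratio [j / N], so the sum is a Riemann sum of step
    [1 / N] for [N] times the integral of [xlim] up to [n / N]. *)
Lemma riemann_xlim (k n : nat) (N : R) (G : R -> R) : 0 < N -> n%:R <= 2 * N -> G 0 = 0 ->
  (forall a b, 0 <= a -> a <= b -> b <= 2 ->
    exists2 c, a <= c <= b & G b - G a = xlim M phi c k * (b - a)) ->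
  `|\sum_(j < n) xlim M phi (j%:R / N) k - N * G (n%:R / N)| <=
    n%:R * (M%:R * dep_cst M phi k / N).
Proof.
move=> N0 n2N G0 HG.
have E : N * G (n%:R / N) = \sum_(j < n) N * (G (j.+1%:R / N) - G (j%:R / N)).
  rewrite -mulr_sumr -(big_mkord xpredT (fun j => G (j.+1%:R / N) - G (j%:R / N))).
  by rewrite telescope_sumr // mul0r G0 subr0.
rewrite E -sumrB; apply: le_trans (ler_norm_sum _ _ _) _.
rewrite -[X in X%:R * _](card_ord n); apply: (@sum_le_card _ _ xpredT) => j _.
have j0 : 0 <= j%:R / N by rewrite divr_ge0 // ltW.
have jj : j%:R / N <= j.+1%:R / N by rewrite ler_wpM2r ?invr_ge0 ?(ltW N0) // ler_nat.
have j2 : j.+1%:R / N <= 2.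
  by rewrite ler_pdivrMr // (le_trans _ n2N) // ler_nat.
have [c /andP[jc cj] ->] := HG _ _ j0 jj j2.
have EN : j.+1%:R / N - j%:R / N = N^-1 by rewrite -mulrBl -natr1 addrAC subrr add0r mul1r.
rewrite EN mulrCA divff ?gt_eqF // mulr1.
apply: le_trans (xlim_lipschitz _ _ _) _.
- by rewrite j0 (le_trans jj).
- by rewrite (le_trans j0 jc) (le_trans cj).
have h : c - j%:R / N <= N^-1 by rewrite lerBlDl (le_trans cj) // addrC -lerBlDr EN.
by rewrite ler_wpM2l ?mulr_ge0 ?dep_cst_ge0 // distrC ger0_norm // subr_ge0.
Qed.

End XlimRegular.

(** The five errors of size [n] are concentration and Riemann sum at both parameters and the
    rounding error on the right; [e] is the cost of passing from odd to even depth. *)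
Lemma slope_bound (R : realType) (n g1 gl e A B X1 Xl Xo W1 Wl : R) :
  - n < A - X1 -> B - Xo < n -> - n <= X1 - g1 -> Xl - gl <= n -> Xo <= Xl + e ->
  A <= W1 -> Wl <= B -> g1 - gl - e - 5 * n <= W1 - Wl - n.
Proof. by lra. Qed.

(** * From maximal weights to the length of the optimum, with high probability *)

Section Assembly.
Variables (R : realType) (d theta : R).
Hypotheses (d_ge1 : 1 <= d) (theta_gt0 : 0 < theta).

Definition exp_edges (n : nat) (dT : measure_display) (T : measurableType dT)
    (P : probability T R) (X : 'I_n -> 'I_n -> T -> R) : Prop :=
  [/\ forall i j : 'I_n, (i < j)%N -> measurable_fun setT (X i j),
      forall i j : 'I_n, (i < j)%N -> forall A : set R, measurable A ->
        P (X i j @^-1` A) = exponential_prob 1 A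
    & edges_independent P (fun e => X e.1 e.2)].

(* [Q] holds outside an event whose probability tends to 0 uniformly over all
   models of the edge weights; [Q] itself need not be measurable. *)
Definition whp (Q : forall n, ('I_n -> 'I_n -> R) -> Prop) : Prop :=
  forall eps : R, 0 < eps -> exists n0, forall n, (n0 <= n)%N ->
    forall (dT : measure_display) (T : measurableType dT) (P : probability T R) X,
    @exp_edges n dT T P X ->
    exists B : set T, [/\ measurable B, (P B <= eps%:E)%E &
      forall w, ~ B w -> Q n (fun i j => X i j w)].

Lemma whp_and Q Q' : whp Q -> whp Q' -> whp (fun n x => Q n x /\ Q' n x).
Proof.
move=> h h' eps eps0; have e2 : 0 < eps / 2 by rewrite divr_gt0.
have [n0 H] := h _ e2; have [n1 H'] := h' _ e2.
exists (maxn n0 n1) => n; rewrite geq_max => /andP[n0n n1n] dT T P X mX.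
have [B [mB PB HB]] := H n n0n dT T P X mX.
have [B' [mB' PB' HB']] := H' n n1n dT T P X mX.
exists (B `|` B'); split; first exact: measurableU.
  apply: (@le_trans _ _ (P B + P B')%E); first exact: measureU2.
  by rewrite [eps]splitr EFinD leeD.
by move=> w /not_orP[nB nB']; split; [exact: HB|exact: HB'].
Qed.

Lemma whp_mono (Q Q' : forall n, ('I_n -> 'I_n -> R) -> Prop) (n1 : nat) :
  (forall n x, (n1 <= n)%N -> Q n x -> Q' n x) -> whp Q -> whp Q'.
Proof.
move=> QQ' h eps eps0; have [n0 H] := h _ eps0.
exists (maxn n0 n1) => n; rewrite geq_max => /andP[n0n n1n] dT T P X mX.
have [B [mB PB HB]] := H n n0n dT T P X mX.
by exists B; split=> // w nB; apply: QQ' => //; exact: HB.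
Qed.

Lemma whp_total (lam : R) (M k : nat) (eps : R) : 0 < lam -> 1 <= 2 * lam `^ d -> (0 < M)%N ->
  0 < eps ->
  whp (fun n x => `|\sum_(j < n) (trunc_gain (levels (level_config d theta lam M x)) k.+1 j
      (below n j))%:R -
    \sum_(j < n) xlim M (powphi d theta M) (j%:R / rate d lam n) k.+1| < eps * n%:R).
Proof.
move=> lam0 lam2 M0 eps0 e e0.
pose e' := Num.min eps e; have e'0 : 0 < e' by rewrite lt_min eps0.
have [n0 H] := @total_concentration R M (powphi d theta M) k e'
  (powphi0 theta d_ge1 M) (@powphi_homo _ _ _ d_ge1 theta_gt0 M) e'0.
exists (maxn n0 1) => n; rewrite geq_max => /andP[n0n n_gt0] dT T P X [X1 X2 X3].
have rate0 := rate_gt0 d lam0 n_gt0.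
have n2 : n%:R <= 2 * rate d lam n.
  by rewrite /rate mulrCA -[leLHS]mulr1 ler_wpM2l.
have {}H := H n (rate d lam n) (@edge_mass R d theta lam M n) n0n n2
  (edge_mass_ge0 d_ge1 theta_gt0 lam0 n_gt0) (edge_mass_sum1 theta lam M d_ge1)
  (fun e b ee => edge_mass_cdf theta lam M d_ge1 b ee).
pose Q (v : {ffun 'I_n * 'I_n -> 'I_M.+1}) := e' * n%:R <=
   `|\sum_(j < n) (trunc_gain (levels v) k.+1 j (below n j))%:R -
    \sum_(j < n) xlim M (powphi d theta M) (j%:R / rate d lam n) k.+1|.
exists [set w | Q (level_config d theta lam M (fun i j => X i j w))]; split.
- exact: (measurable_config_pred d theta lam X1 Q).
- apply: le_trans (prob_config_pred d_ge1 theta_gt0 lam0 M0 n_gt0 X1 X2 X3 Q) _.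
  by rewrite lee_fin; apply: le_trans H _; rewrite ge_min lexx orbT.
- move=> w /negP; rewrite /Q -ltNge => h; apply: lt_le_trans h _.
  by rewrite ler_wpM2r // ge_min lexx.
Qed.

(** The slope needs [W 1] from below, hence an even depth, and [W lam] from above, hence an odd
    depth; the gap hypothesis moves the odd sum to even depth so that one [G] serves both. *)
Lemma whp_slope (lam e2 : R) (M k : nat) (G : R -> R) :
  0 < lam -> 1 <= 2 * lam `^ d -> (0 < M)%N -> G 0 = 0 ->
  (forall a b, 0 <= a -> a <= b -> b <= 2 -> exists2 c, a <= c <= b &
     G b - G a = xlim M (powphi d theta M) c k.*2.+2 * (b - a)) ->
  (forall s, 0 <= s <= 2 -> xlim M (powphi d theta M) s k.*2.+1 -
     xlim M (powphi d theta M) s k.*2.+2 <= M%:R * e2) ->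
  whp (fun n x => theta / M%:R * (n%:R * (G 1 - lam `^ d * G ((lam `^ d)^-1) - M%:R * e2 - 5))
     <= (lam - 1) * opt_dm_length (edge_lengths d x) theta).
Proof.
move=> lam0 lam2 M0 G0 HG gap.
set phi := powphi d theta M in HG gap.
have phi0 : phi 0%N = 0 by exact: powphi0.
have homo : {homo phi : a b / (a <= b)%N >-> a <= b} by exact: powphi_homo.
have one2 : 1 <= 2 * 1 `^ d :> R by rewrite powR1; lra.
pose L := M%:R * dep_cst M phi k.*2.+2.
have L0 : 0 <= L by rewrite mulr_ge0 // dep_cst_ge0.
(* Accuracy 1 is enough: an error of [n] levels is worth a length of [theta / M] per vertex, which a
   large [M] absorbs. *)
have h := whp_and (@whp_total 1 M k.*2.+1 1 ltr01 one2 M0 ltr01)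
  (@whp_total lam M k.*2 1 lam0 lam2 M0 ltr01).
apply: (whp_mono (n1 := (Num.truncn (2 * L)).+1) _ h) => {h} n x nL [h1 hlam].
have n_gt0 : (0 < n)%N by exact: leq_trans nL.
have nR : 0 < n%:R :> R by rewrite ltr0n.
have nL' : 2 * L <= n%:R.
  by apply/ltW/(lt_le_trans (truncnS_gt _)); rewrite ler_nat.
have riem (mu : R) : 0 < mu -> 1 <= 2 * mu `^ d ->
    `|\sum_(j < n) xlim M phi (j%:R / rate d mu n) k.*2.+2 -
      n%:R * (mu `^ d * G ((mu `^ d)^-1))| <= n%:R.
  move=> mu0 mu2; have N0 := rate_gt0 d mu0 n_gt0.
  have n2N : n%:R <= 2 * rate d mu n by rewrite /rate mulrCA -[leLHS]mulr1 ler_wpM2l.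
  have := riemann_xlim phi0 homo N0 n2N G0 HG.
  have -> : n%:R / rate d mu n = (mu `^ d)^-1.
    by rewrite /rate invfM mulrA divff ?mul1r // gt_eqF.
  rewrite {2}/rate -mulrA => H; apply: le_trans H _.
  rewrite -/L -[leRHS]mulr1 ler_wpM2l // ler_pdivrMr // mul1r; lra.
pose W mu := (max_weight (levels (level_config d theta mu M x)) [set: 'I_n]%SET)%:R : R.
pose tg mu k' := (\sum_(j < n) (trunc_gain (levels (level_config d theta mu M x)) k' j
  (below n j))%:R) : R.
have Wodd mu : W mu <= tg mu k.*2.+1.
  rewrite /W /tg max_weight_sum natr_sum; apply: ler_sum => j _; rewrite ler_nat.
  have := trunc_gain_odd_even (levels (level_config d theta mu M x)) k.*2.+1 (below_notin j).
  by rewrite oddS odd_double.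
have Weven mu : tg mu k.*2.+2 <= W mu.
  rewrite /W /tg max_weight_sum natr_sum; apply: ler_sum => j _; rewrite ler_nat.
  have := trunc_gain_odd_even (levels (level_config d theta mu M x)) k.*2.+2 (below_notin j).
  by rewrite !oddS odd_double.
have lvl mu e : is_edge e -> levels (level_config d theta mu M x) e =
    level_of_length theta mu M (edge_lengths d x e.1 e.2).
  by move=> ee; rewrite /levels ffunE ee inordK // ltnS leq_subr.
have slope := opt_length_slope M0 theta_gt0 lam0
  (fun e => powR_ge0 (n%:R * x e.1 e.2) d^-1) (lvl 1) (lvl lam).
apply: le_trans slope; rewrite -/(W 1) -/(W lam).
rewrite ler_wpM2l //; first by rewrite divr_ge0 // ltW.
have r1 := riem 1 ltr01 one2; rewrite powR1 invr1 mul1r in r1.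
have rl := riem lam lam0 lam2.
have odd_even : \sum_(j < n) xlim M phi (j%:R / rate d lam n) k.*2.+1 <=
    \sum_(j < n) xlim M phi (j%:R / rate d lam n) k.*2.+2 + n%:R * (M%:R * e2).
  rewrite -lerBlDl -sumrB -[X in X%:R * _](card_ord n); apply: (@sum_le_card _ _ xpredT) => j _.
  apply: gap; rewrite divr_ge0 ?(ltW (rate_gt0 _ _ _)) //= ler_pdivrMr ?rate_gt0 //.
  apply: (@le_trans _ _ n%:R); first by rewrite ler_nat ltnW.
  by rewrite /rate mulrCA -[leLHS]mulr1 ler_wpM2l.
have := Weven 1; have := Wodd lam; rewrite /tg.
move: h1 hlam r1 rl odd_even; rewrite -/phi mul1r !ltr_norml !ler_norml.
move=> /andP[a1 _] /andP[_ b2] /andP[c1 _] /andP[_ d2] oe w1 w2.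
rewrite !mulrBr [n%:R * 5]mulrC; exact: slope_bound a1 b2 c1 d2 oe w2 w1.
Qed.

Lemma powR_slope (e : R) : 0 < e -> exists2 r, 0 < r & forall h, 0 < h -> h < r ->
  `|((1 + h) `^ d - 1) - d * h| <= e * h /\ `|(1 - (1 - h) `^ d) - d * h| <= e * h.
Proof.
move=> e0; have [der val] := is_derive1_powR d (@ltr01 R).
rewrite powR1 mulr1 in val.
have /cvgrPdist_le/(_ e e0) : h^-1 *: (((fun x : R => x `^ d) \o shift (1 : R)) (h *: (1 : R)) -
    (1 : R) `^ d) @[h --> 0^'] --> d.
  by rewrite -[X in _ --> X]val; exact: der.
rewrite /at_right near_withinE => -[r /= r0 hr].
have key (t : R) : t != 0 -> `|t| < r -> `|(1 + t) `^ d - 1 - d * t| <= e * `|t|.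
  move=> t0 tr; have := hr t; rewrite /= sub0r normrN => /(_ tr t0).
  rewrite /GRing.scale /= mulr1 powR1 [t + 1]addrC => H.
  rewrite -ler_pdivrMr ?normr_gt0 // -normf_div; apply: le_trans H.
  by rewrite -normrN le_eqVlt; apply/orP; left; apply/eqP; congr (`|_|); field.
exists r => // h h0 hr'; split.
  by have := key h; rewrite gt_eqF // gtr0_norm // => /(_ isT hr').
have := key (- h); rewrite oppr_eq0 gt_eqF // normrN gtr0_norm // => /(_ isT hr').
by rewrite -normrN; congr (`|_| <= _); ring.
Qed.

(** Order of the choices: [e1] fixes the admissible distance [eta1] of two ratios and [eta1] limits
    the step [h]. Only then come [e2], proportional to [h] because slopes divide by [h], the mesh
    [M], and finally the depth [k]. Here [e1] controls the difference of the mean gains at two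
    ratios, [e2] the gap between odd and even depth at one ratio. *)
Lemma small_interval (eps : R) : 0 < eps -> exists lo hi : R, hi - lo <= eps /\
  whp (fun n x => lo <= opt_dm_length (edge_lengths d x) theta / n%:R <= hi).
Proof.
move=> eps0; have dge := d_ge1; have th0 := theta_gt0.
have [K KE] : {K | K = d + 1} by exists (d + 1).
have K0 : 0 < K by rewrite KE; lra.
pose e1 := eps / (8 * (theta * K)).
have e1_gt0 : 0 < e1 by rewrite divr_gt0 // mulr_gt0 // mulr_gt0.
have e1E : theta * K * e1 = eps / 8.
  by rewrite /e1; field; rewrite gt_eqF //= gt_eqF.
have [eta1 eta1_gt0 [M1 rs1]] := replica_symmetry d_ge1 theta_gt0 e1_gt0.
pose e := Num.min 1 (eps / (16 * theta)).
have e_gt0 : 0 < e by rewrite lt_min ltr01 divr_gt0 // mulr_gt0.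
have e_le1 : e <= 1 by rewrite ge_min lexx.
have eE : 2 * theta * e <= eps / 8.
  have : e <= eps / (16 * theta) by rewrite ge_min lexx orbT.
  by rewrite ler_pdivlMr ?mulr_gt0 //; nra.
clearbody e e1.
have [r r0 hslope] := powR_slope e_gt0.
(* [K * h] will bound the distance of [(1 + h) ^ d] and [(1 - h) ^ d] from 1. The three terms secure
   the derivative estimate, then [1 / 2 <= am], which keeps the ratios in [[0, 2]], and then a
   distance of at most [eta1] between the ratios [c1] and [c2]. *)
pose h := Num.min (r / 2) (Num.min (1 / (2 * K)) (eta1 / (3 * K))).
have h0 : 0 < h by rewrite !lt_min !divr_gt0 // mulr_gt0.
have hr : h < r.
  by apply: (@le_lt_trans _ _ (r / 2)); rewrite ?ge_min ?lexx // ltr_pdivrMr //; lra.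
have hK : K * h <= 1 / 2.
  have : h <= 1 / (2 * K) by rewrite !ge_min lexx !orbT.
  by rewrite ler_pdivlMr ?mulr_gt0 //; nra.
have heta : 3 * (K * h) <= eta1.
  have : h <= eta1 / (3 * K) by rewrite !ge_min lexx !orbT.
  by rewrite ler_pdivlMr ?mulr_gt0 //; nra.
clearbody h.
have h1 : h <= 1 / 2 by apply: le_trans hK; rewrite ler_peMl ?(ltW h0) // KE; lra.
have [sp sm] := hslope h h0 hr.
set ap := (1 + h) `^ d in sp; set am := (1 - h) `^ d in sm.
have {hslope} [sp1 sp2] : d * h - e * h <= ap - 1 /\ ap - 1 <= d * h + e * h.
  by move: sp; rewrite ler_norml => /andP[]; split; lra.
have [sm1 sm2] : d * h - e * h <= 1 - am /\ 1 - am <= d * h + e * h.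
  by move: sm; rewrite ler_norml => /andP[]; split; lra.
have eh : 0 <= e * h /\ e * h <= h by split; nra.
have dh : h <= d * h by nra.
have KhE : K * h = d * h + h by rewrite KE mulrDl mul1r.
have ap1 : 1 <= ap by lra.
have apK : ap - 1 <= K * h by lra.
have am1 : am <= 1 by lra.
have amK : 1 - am <= K * h by lra.
have am0 : 1 / 2 <= am by lra.
pose e2 := h * eps / (16 * theta).
have e2_gt0 : 0 < e2 by rewrite divr_gt0 ?mulr_gt0.
have e2E : theta * e2 = h * eps / 16 by rewrite /e2; field; rewrite gt_eqF.
have [eta2 eta2_gt0 [M2 rs2]] := replica_symmetry d_ge1 theta_gt0 e2_gt0.
clearbody e2.
pose M := maxn (maxn M1 M2) (Num.truncn (40 * theta / (h * eps))).+1.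
have M1M : (M1 <= M)%N by rewrite /M !leq_max leqnn.
have M2M : (M2 <= M)%N by rewrite /M !leq_max leqnn orbT.
have Mgt0 : (0 < M)%N by rewrite /M !leq_max ltn0Sn orbT.
have MR0 : 0 < M%:R :> R by rewrite ltr0n.
have Mbig : 10 * theta <= M%:R * (h * eps / 4).
  have : 40 * theta / (h * eps) <= M%:R.
    by apply/ltW/(lt_le_trans (truncnS_gt _)); rewrite ler_nat leq_maxr.
  by rewrite ler_pdivrMr ?mulr_gt0 //; lra.
have [k [k1 k2]] : exists k,
    (forall s s', 0 <= s <= 2 -> 0 <= s' <= 2 -> `|s - s'| <= eta1 ->
      xlim M (powphi d theta M) s k.*2.+1 - xlim M (powphi d theta M) s' k.*2.+2 <= M%:R * e1) /\
    (forall s s', 0 <= s <= 2 -> 0 <= s' <= 2 -> `|s - s'| <= eta2 ->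
      xlim M (powphi d theta M) s k.*2.+1 - xlim M (powphi d theta M) s' k.*2.+2 <= M%:R * e2).
  exact: (@filter_ex _ \oo _ _ (filterI (rs1 M M1M Mgt0) (rs2 M M2M Mgt0))).
clearbody M.
set phi := powphi d theta M in k1 k2.
have phi0 : phi 0%N = 0 by exact: powphi0.
have homo : {homo phi : a b / (a <= b)%N >-> a <= b} by exact: powphi_homo.
have [G G0 HG] := antiderivative (@continuous_xlim R M phi k.*2.+2).
have gap s : 0 <= s <= 2 -> xlim M phi s k.*2.+1 - xlim M phi s k.*2.+2 <= M%:R * e2.
  by move=> hs; apply: k2 => //; rewrite subrr normr0 ltW.
have low : 1 <= 2 * am by clear -am0; lra.
have hip : 1 <= 2 * ap by clear -ap1; lra.
have wp := @whp_slope (1 + h) e2 M k G (addr_gt0 ltr01 h0) hip Mgt0 G0 HG gap.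
have hm0 : 0 < 1 - h by clear -h1 dge th0; lra.
have wm := @whp_slope (1 - h) e2 M k G hm0 low Mgt0 G0 HG gap.
pose lo := theta / M%:R * (G 1 - ap * G ap^-1 - M%:R * e2 - 5) / h.
pose hi := - (theta / M%:R * (G 1 - am * G am^-1 - M%:R * e2 - 5)) / h.
exists lo, hi; split; last first.
  apply: (whp_mono (n1 := 1) _ (whp_and wp wm)) => n x n1.
  have n0 : 0 < n%:R :> R by rewrite ltr0n.
  rewrite -/ap -/am => -[hp hm]; apply/andP; split.
    rewrite ler_pdivlMr // /lo mulrAC ler_pdivrMr // [leRHS]mulrC.
    move: hp; rewrite (_ : 1 + h - 1 = h) => [|]; last by ring.
    by rewrite mulrA mulrAC.
  rewrite ler_pdivrMr // /hi mulrAC ler_pdivlMr // mulNr lerNr [opt_dm_length _ _ * h]mulrC.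
  move: hm; rewrite (_ : 1 - h - 1 = - h) => [|]; last by ring.
  by rewrite [- h * _]mulNr mulrA mulrAC.
have G1 : exists2 c, 0 <= c <= 1 & G 1 = xlim M phi c k.*2.+2.
  by have [c hc] := HG 0 1 (lexx 0) ler01 (ler1n R 2); rewrite G0 !subr0 mulr1; exists c.
have am_pos : 0 < am by clear -am0; lra.
have ap_pos : 0 < ap by clear -ap1; lra.
have amI : 1 <= am^-1 by rewrite -[leLHS]invr1 lef_pV2 ?posrE.
have amI2 : am^-1 <= 2 by rewrite -[leRHS]invrK lef_pV2 ?posrE ?invr_gt0 //; clear -am0; lra.
have apI : ap^-1 <= 1 by rewrite -[leRHS]invr1 lef_pV2 ?posrE.
have apI0 : 0 <= ap^-1 by rewrite invr_ge0 ltW.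
have [c1 /andP[c1l c1u] Ec1] := HG 1 am^-1 ler01 amI amI2.
have [c2 /andP[c2l c2u] Ec2] := HG ap^-1 1 apI0 apI (ler1n R 2).
set x1 := xlim M phi c1 k.*2.+2 in Ec1; set x2 := xlim M phi c2 k.*2.+2 in Ec2.
(* Increments of [a * G (1 / a)] on the two sides of [a = 1], in the mean value form of [G]. *)
have Em : am * G am^-1 - G 1 = (1 - am) * (x1 - G 1).
  have -> : G am^-1 = G 1 + x1 * (am^-1 - 1) by rewrite -Ec1; ring.
  by field; rewrite gt_eqF.
have Ep : ap * G ap^-1 - G 1 = (ap - 1) * (G 1 - x2).
  have -> : G ap^-1 = G 1 - x2 * (1 - ap^-1) by rewrite -Ec2; ring.
  by field; rewrite gt_eqF.
have c12 : `|c1 - c2| <= eta1.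
  have q1 : am^-1 - 1 <= 2 * (K * h).
    have -> : am^-1 - 1 = (1 - am) * am^-1 by rewrite mulrBl mul1r divff ?gt_eqF.
    by clear -am1 amK amI2; nra.
  have q2 : 1 - ap^-1 <= K * h.
    have -> : 1 - ap^-1 = (ap - 1) * ap^-1 by rewrite mulrBl mul1r divff ?gt_eqF.
    by clear -ap1 apK apI; nra.
  by clear -q1 q2 heta c1l c1u c2l c2u; rewrite ler_norml; apply/andP; split; lra.
have c1r : 0 <= c1 <= 2 by clear -c1l c1u amI2; apply/andP; split; lra.
have c2r : 0 <= c2 <= 2 by clear -c2l c2u apI0; apply/andP; split; lra.
(* [k1] compares odd depth at [c1] with even depth at [c2]; at [c1] the even value lies below the
   odd one. *)
have x12 : x1 - x2 <= M%:R * e1.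
  have := k1 c1 c2 c1r c2r c12; have := xlim_even_le_odd M homo k (proj1 (andP c1r)).
  by rewrite -/x1 -/x2; clear -x1 x2; lra.
have [cG /andP[cG0 _] EG] := G1.
have /andP[g0 gM] := xlim_bounds M homo k.*2.+2 cG0.
have /andP[y0 yM] := xlim_bounds M homo k.*2.+2 (proj1 (andP c2r)).
rewrite -EG in g0 gM; rewrite -/x2 in y0 yM.
(* In the second product [1 - am] and [ap - 1] share the main term [d * h], so they differ by at
   most [2 * (e * h)], while the mean gains [x2] and [G 1] lie in [[0, M]]. *)
have main : (1 - am) * (x1 - x2) + ((1 - am) - (ap - 1)) * (x2 - G 1) <=
    M%:R * (K * h * e1 + 2 * (e * h)).
  have t1 : (1 - am) * (x1 - x2) <= K * h * (M%:R * e1).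
    apply: (@le_trans _ _ ((1 - am) * (M%:R * e1))).
      by rewrite ler_wpM2l // subr_ge0.
    by rewrite ler_wpM2r // mulr_ge0 // ltW.
  have t2 : ((1 - am) - (ap - 1)) * (x2 - G 1) <= 2 * (e * h) * M%:R.
    apply: le_trans (ler_norm _) _; rewrite normrM; apply: ler_pM => //.
      by clear -sm1 sm2 sp1 sp2; rewrite ler_norml; apply/andP; split; lra.
    by clear -g0 gM y0 yM; rewrite ler_norml; apply/andP; split; lra.
  by rewrite [leRHS]mulrDr [M%:R * (K * _ * _)]mulrCA [M%:R * (2 * _)]mulrC; exact: lerD.
have -> : hi - lo = theta / M%:R / h *
   ((1 - am) * (x1 - x2) + ((1 - am) - (ap - 1)) * (x2 - G 1) + 2 * (M%:R * e2) + 10).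
  have -> : (1 - am) * (x1 - x2) + ((1 - am) - (ap - 1)) * (x2 - G 1) =
    (1 - am) * (x1 - G 1) + (ap - 1) * (G 1 - x2) by ring.
  by rewrite -Em -Ep /hi /lo; field; rewrite !gt_eqF.
apply: (@le_trans _ _ (theta / M%:R / h * (M%:R * (K * h * e1 + 2 * (e * h)) + 2 * (M%:R * e2) + 10))).
  by rewrite ler_wpM2l ?lerD2r // !divr_ge0 // ltW.
have -> : theta / M%:R / h * (M%:R * (K * h * e1 + 2 * (e * h)) + 2 * (M%:R * e2) + 10) =
   theta * K * e1 + 2 * theta * e + 2 * (theta * e2) / h + 10 * theta / (M%:R * h).
  by field; rewrite !gt_eqF.
have u1 : 2 * (theta * e2) / h = eps / 8 by rewrite e2E; field; rewrite gt_eqF.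
have u2 : 10 * theta / (M%:R * h) <= eps / 4.
  by rewrite ler_pdivrMr ?mulr_gt0 //; apply: le_trans Mbig _; clear -eps; lra.
by rewrite u1 e1E; clear -u2 eE eps0; lra.
Qed.

End Assembly.

Definition mean_length_between (R : realType) (d theta lo hi : R) :=
  whp (fun n (x : 'I_n -> 'I_n -> R) =>
    lo <= opt_dm_length (edge_lengths d x) theta / n%:R <= hi).

(** An exceptional set of probability at most [1 / 2] is not the whole space, so some sample of the
    given model lies in both intervals for the same [n]. *)
Lemma mean_length_overlap (R : realType) (d theta : R) lo hi lo' hi'
    (dT : measure_display) (T : measurableType dT) (P : probability T R)
    (X : forall n, 'I_n -> 'I_n -> T -> R) :
  (forall n, exp_edges P (X n)) ->
  mean_length_between d theta lo hi -> mean_length_between d theta lo' hi' -> lo <= hi'.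
Proof.
move=> hX b b'; have h2 : 0 < 1 / 2 :> R by lra.
have [n /(_ n (leqnn n) dT T P _ (hX n)) [B [mB PB HB]]] := whp_and b b' h2.
have [w nBw] : exists w, ~ B w.
  apply: contrapT => /forallNP Bw; have BT : B = setT.
    by rewrite predeqE => w; split=> // _; apply: contrapT; exact: Bw.
  by move: PB; rewrite BT probability_setT lee_fin; lra.
by have [/andP[l _] /andP[_ u]] := HB w nBw; exact: le_trans u.
Qed.

Theorem theorem2 (R : realType) (d theta : R) (hd : 1 <= d) (htheta : 0 < theta) :
  exists beta : R,
  forall (dT : measure_display) (T : measurableType dT) (P : probability T R)
         (X : forall n : nat, 'I_n -> 'I_n -> T -> R),
    (forall n (i j : 'I_n), (i < j)%N -> measurable_fun setT (X n i j)) ->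
    (forall n (i j : 'I_n), (i < j)%N ->
       forall A : set R, measurable A ->
         P (X n i j @^-1` A) = exponential_prob 1 A) ->
    (forall n, edges_independent P (fun e => X n e.1 e.2)) ->
    forall eps : R, 0 < eps ->
      (fun n => P [set w | eps <= `| M_n d theta (X n) w / n%:R - beta | ])
        @ \oo --> 0%E.
Proof.
(* The limit has to be named before the probability space. It is the supremum of all asymptotic
   lower bounds; once a model is given, [mean_length_overlap] bounds these by every asymptotic upper
   bound, so the limit lies in each interval provided by [small_interval]. *)
pose S := [set lo | exists hi, mean_length_between d theta lo hi].
exists (sup S) => dT T P X Xmeas Xlaw Xind eps eps0.
have hX n : exp_edges P (X n) by split; [exact: Xmeas|exact: Xlaw|exact: Xind].
have e2 : 0 < eps / 2 by rewrite divr_gt0.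
have [lo [hi [lohi b]]] := small_interval hd htheta e2.
have ubS : ubound S hi by move=> lo' [hi' b']; exact: mean_length_overlap hX b' b.
have Slo : S lo by exists hi.
have lo_le : lo <= sup S by apply: ub_le_sup => //; exists hi.
have le_hi : sup S <= hi by apply: ge_sup => //; exists lo.
have mE n : measurable [set w | eps <= `|M_n d theta (X n) w / n%:R - sup S|].
  rewrite -[X in measurable X]setTI.
  apply: (@measurable_fun_le _ _ _ setT (cst eps)) => //.
  apply: measurableT_comp => //; apply: measurable_funB => //.
  apply: measurable_funM => //.
  apply: measurable_opt_dm_length => i j ij.
  apply: (measurableT_comp (measurable_powR d^-1)).
  by apply: measurable_funM => //; exact: Xmeas.
rewrite -[0%E]/(0%:E); apply/fine_cvgP; split.
  by near=> n; exact: fin_num_measure.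
apply/cvgrPdist_le => e e0; have [n0 H] := b e e0.
exists n0 => //= n /= n0n; have [B [mB PB HB]] := H n n0n dT T P _ (hX n).
rewrite sub0r normrN ger0_norm ?fine_ge0 // -lee_fin fineK ?fin_num_measure //.
apply: le_trans PB; apply: le_measure; rewrite ?inE // => w /= hw.
apply: contrapT => /HB; rewrite -/(M_n d theta (X n) w) => /andP[l u].
have : `|M_n d theta (X n) w / n%:R - sup S| <= hi - lo.
  by rewrite ler_norml; apply/andP; split; lra.
by move=> /(le_trans hw); lra.
Unshelve. all: by end_near.
Qed.
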